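(* Let $\Omega\subset\mathbb{R}^n$ be a bounded domain satisfying uniform interior and exterior sphere conditions, and let $0<\lambda<\Lambda$. Let $F:S(n)\to\mathbb{R}$ satisfy $F(0)=0$ and $$\mathcal{M}^-(X-Y)\le F(X)-F(Y)\le\mathcal{M}^+(X-Y)\quad\text{for all }X,Y\in S(n).$$ Let $h:\mathbb{R}\to\mathbb{R}$ be such that: (a) $h(s)$ is positive and nondecreasing for $s>0$; (b) $s\mapsto s^2h(s)$ is convex on $[0,\infty)$; (c) there is $C>0$ such that $h(yz)\le C(h(y)+h(z))$ for all sufficiently large $y,z>0$; (d) $\displaystyle\int_1^\infty\frac{1}{s\,h(s)}\,ds<\infty.$ Let $f:\mathbb{R}^n\to\mathbb{R}$ be continuous with $f(\xi)\ge|\xi|^2h(|\xi|)$ for all $\xi\in\mathbb{R}^n$. Then there exists $u_0\in C^1(\overline\Omega)$ with $u_0\ge0$ and $u_0|_{\partial\Omega}=0$ such that loss of boundary conditions occurs in some finite time $T=T(u_0)$ for solutions $u$ of $$u_t-F(D^2u)=f(Du)\ \text{ in }\Omega\times(0,\infty),\qquad u=0\ \text{ on }\partial\Omega\times(0,\infty),\qquad u(\cdot,0)=u_0\ \text{ in }\overline\Omega,$$ where the boundary condition is understood in the viscosity sense.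
   Context: $S(n)$ denotes the real symmetric $n\times n$ matrices with the usual ordering. For $0<\lambda<\Lambda$ and $X\in S(n)$, Pucci's operators are $\mathcal{M}^-(X)=\inf\{\mathrm{tr}(AX): A\in S(n),\ \lambda I\le A\le\Lambda I\}$ and $\mathcal{M}^+(X)=\sup\{\mathrm{tr}(AX): A\in S(n),\ \lambda I\le A\le\Lambda I\}$. Uniform interior (exterior) sphere condition: there is a radius $\eta>0$ such that for every $x_0\in\partial\Omega$ there is an open ball of radius $\eta$ contained in $\Omega$ (respectively in $\mathbb{R}^n\setminus\overline\Omega$) whose boundary contains $x_0$. A solution is a continuous function $u$ on $\overline\Omega\times[0,\infty)$ which is a viscosity solution of the equation in $\Omega\times(0,\infty)$, satisfies $u(\cdot,0)=u_0$ pointwise on $\overline\Omega$, and satisfies $u=0$ on $\partial\Omega\times(0,\infty)$ in the viscosity sense, that is: at points of $\partial\Omega\times(0,\infty)$, $$\min\big(u_t-F(D^2u)-f(Du),\,u\big)\le 0\quad\text{and}\quad \max\big(u_t-F(D^2u)-f(Du),\,u\big)\ge 0$$ hold in the viscosity sense (the first with derivatives replaced by those of any smooth test function touching $u$ from above at the point relative to $\overline\Omega\times(0,\infty)$, the second with those of any smooth test function touching $u$ from below). Loss of boundary conditions (LOBC) occurs when $u=0$ on the lateral boundary fails in the classical (pointwise) sense; LOBC at time $T$ means that $u(x,T)\ne0$ for some $x\in\partial\Omega$. *)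

(* Defs.v *)
From HB Require Import structures.
From mathcomp Require Import all_boot all_order all_algebra.
From mathcomp Require Import all_classical all_reals all_analysis.

Set Implicit Arguments.
Unset Strict Implicit.
Unset Printing Implicit Defensive.

Import Order.TTheory GRing.Theory Num.Theory.
Import numFieldNormedType.Exports.

Local Open Scope classical_set_scope.
Local Open Scope ring_scope.

(* The library norm on ['rV[R]_n] is the sup norm: it yields the usual topology
   and the usual bounded sets, but balls and |xi| have to be Euclidean. *)
Definition enorm (R : realType) (n : nat) (x : 'rV[R]_n) : R :=
  Num.sqrt (\sum_(i < n) x 0 i ^+ 2).

Definition eball (R : realType) (n : nat) (y : 'rV[R]_n) (r : R) :
    set 'rV[R]_n :=
  [set x | enorm (x - y) < r].

Definition bdry (T : topologicalType) (A : set T) : set T :=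
  closure A `\` interior A.

Definition bounded_domain (R : realType) (n : nat) (Omega : set 'rV[R]_n) :=
  [/\ open Omega, connected Omega, Omega !=set0 & bounded_set Omega].

Definition interior_sphere (R : realType) (n : nat) (Omega : set 'rV[R]_n) :=
  exists2 eta : R, 0 < eta &
    forall x0, bdry Omega x0 ->
      exists2 y, eball y eta `<=` Omega & enorm (x0 - y) = eta.

Definition exterior_sphere (R : realType) (n : nat) (Omega : set 'rV[R]_n) :=
  exists2 eta : R, 0 < eta &
    forall x0, bdry Omega x0 ->
      exists2 y, eball y eta `<=` ~` closure Omega & enorm (x0 - y) = eta.

Definition symm (R : realType) (n : nat) : set 'M[R]_n := [set X | X^T = X].

Definition loewner_le (R : realType) (n : nat) (X Y : 'M[R]_n) :=
  forall v : 'rV[R]_n, (v *m X *m v^T) 0 0 <= (v *m Y *m v^T) 0 0.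

Definition pucci_set (R : realType) (n : nat) (lam Lam : R) : set 'M[R]_n :=
  [set A | [/\ symm A, loewner_le lam%:M A & loewner_le A Lam%:M]].

Definition pucci_minus (R : realType) (n : nat) (lam Lam : R) (X : 'M[R]_n) : R :=
  inf [set \tr (A *m X) | A in pucci_set lam Lam].

Definition pucci_plus (R : realType) (n : nat) (lam Lam : R) (X : 'M[R]_n) : R :=
  sup [set \tr (A *m X) | A in pucci_set lam Lam].

(* [F] stands for an operator on S(n): nothing is assumed about its values on
   non-symmetric matrices. *)
Definition uniformly_elliptic (R : realType) (n : nat) (lam Lam : R)
    (F : 'M[R]_n -> R) :=
  forall X Y, symm X -> symm Y ->
    pucci_minus lam Lam (X - Y) <= F X - F Y <= pucci_plus lam Lam (X - Y).

(* Space-time derivatives are directional derivatives in ['rV[R]_n * R]. *)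
Section SpaceTime.
Variables (R : realType) (n : nat).
Implicit Types (phi u : 'rV[R]_n * R -> R) (z w : 'rV[R]_n * R).

Definition dir_x (i : 'I_n) : 'rV[R]_n * R := (delta_mx 0 i, 0).
Definition dir_t : 'rV[R]_n * R := (0, 1).

Definition dx (i : 'I_n) phi : 'rV[R]_n * R -> R := 'D_(dir_x i) phi.
Definition dt phi : 'rV[R]_n * R -> R := 'D_dir_t phi.

Definition grad_x phi z : 'rV[R]_n := \row_i dx i phi z.
Definition hess_x phi z : 'M[R]_n := \matrix_(i, j) dx i (dx j phi) z.

(* C^{2,1} regularity (twice in x, once in t) in a neighbourhood of [z] *)
Definition C21_near phi z :=
  \forall w \near z,
    [/\ derivable phi w dir_t /\ {for w, continuous (dt phi)},
        forall i, derivable phi w (dir_x i) /\ {for w, continuous (dx i phi)} &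
        forall i j, derivable (dx j phi) w (dir_x i) /\
                    {for w, continuous (dx i (dx j phi))}].

Definition touches_above (D : set ('rV[R]_n * R)) u phi z :=
  phi z = u z /\ \forall w \near z, D w -> u w <= phi w.

Definition touches_below (D : set ('rV[R]_n * R)) u phi z :=
  phi z = u z /\ \forall w \near z, D w -> phi w <= u w.

Variables (Omega : set 'rV[R]_n) (F : 'M[R]_n -> R) (f : 'rV[R]_n -> R).

Definition residual phi z : R :=
  dt phi z - F (hess_x phi z) - f (grad_x phi z).

Definition viscosity_interior u :=
  forall z, (Omega `*` [set t | 0 < t]) z -> forall phi, C21_near phi z ->
    (touches_above (Omega `*` [set t | 0 < t]) u phi z ->
       residual phi z <= 0) /\
    (touches_below (Omega `*` [set t | 0 < t]) u phi z ->
       0 <= residual phi z).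

Definition viscosity_boundary u :=
  forall z, (bdry Omega `*` [set t | 0 < t]) z -> forall phi, C21_near phi z ->
    (touches_above (closure Omega `*` [set t | 0 < t]) u phi z ->
       Num.min (residual phi z) (u z) <= 0) /\
    (touches_below (closure Omega `*` [set t | 0 < t]) u phi z ->
       0 <= Num.max (residual phi z) (u z)).

(* Only the values of [u] on closure(Omega) x [0, +oo[ matter. *)
Definition is_solution (u0 : 'rV[R]_n -> R) u :=
  [/\ {within closure Omega `*` [set t | 0 <= t], continuous u},
      viscosity_interior u,
      viscosity_boundary u &
      forall x, closure Omega x -> u (x, 0) = u0 x].

Definition LOBC_at u (T : R) := exists2 x, bdry Omega x & u (x, T) <> 0.

(* C^1 on the closure: [u0] is continuous there, and its gradient in [Omega]
   extends continuously to the closure. *)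
Definition C1_closure (u0 : 'rV[R]_n -> R) :=
  {within closure Omega, continuous u0} /\
  exists2 g : 'rV[R]_n -> 'rV[R]_n, {within closure Omega, continuous g} &
    forall x, Omega x -> forall i : 'I_n,
      derivable u0 x (delta_mx 0 i) /\ 'D_(delta_mx 0 i) u0 x = g x 0 i.

End SpaceTime.

(* Main.v *)
Require Import Defs.
From HB Require Import structures.
From mathcomp Require Import all_boot all_order all_algebra.
From mathcomp Require Import all_classical all_reals all_analysis.
From mathcomp Require Import measurable_realfun.
From mathcomp Require Import ring lra.

Import Order.TTheory GRing.Theory Num.Theory.
Import numFieldNormedType.Exports.

Local Open Scope classical_set_scope.
Local Open Scope ring_scope.

Set Implicit Arguments.
Unset Strict Implicit.

(** The boundary condition is lost because explicit smooth strict subsolutions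
    push the solution up near one boundary point.

    Pick a boundary point [x0] and an interior ball of radius [rho] and centre
    [y] touching the boundary there; write [q] for the squared distance to [y]
    and [Q = rho ^+ 2]. Consider
      [phi (x, t) = G (q + delta) + A * t * (q - Q / 2) - B * t ^+ 2]
    with a decreasing concave [G] whose slope is a large constant [m] away from
    [Q] and becomes enormous near [Q]. Near the centre the drift makes [phi]
    decrease in time, which pays for the diffusion. Away from the centre the
    gradient is at least of order [m], so the superquadratic term beats both the
    increase in time, which is of order [m] only, and the second order terms,
    provided that the slope [p] of [G] satisfies
    [p' <= c * p ^+ 2 * h (c' * p)].
    The equation with equality blows up at finite height exactly when
    [1 / (s * h s)] is integrable at infinity. Here it is replaced by successive
    doublings of the slope, whose total height is a tail of the series of the
    [1 / h (2 ^+ k)] ([dyadic_tail_small], [curvature_le], [profile_end]).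

    The slope of [G] can be taken so large, depending on the shift [delta], that
    [phi <= 0] outside the ball although [phi >= 1 / 2] at [q = Q - delta] at
    a time [T] independent of [delta] ([barrier_outside], [barrier_rim]).
    Solutions are nonnegative ([solution_ge0]) and stay above smooth functions
    with negative residual ([comparison]); the viscosity boundary condition only
    matters through [u >= 0], so a barrier that is nonpositive on the boundary
    is compared with [u] at interior points. One initial datum dominates all the
    barriers ([barrier_start]), hence [u (x, T) >= 1 / 2] for points [x] of the
    ball arbitrarily close to [x0] ([solution_large_at_rim]), and continuity
    forbids [u (x0, T) = 0]. *)

(** * Derivatives *)

Section Derivatives.
Variable R : realType.

(** Avoids difference quotients: for functions whose Taylor remainder is
    visibly quadratic, the derivative is read off an algebraic inequality. *)
Lemma is_derive_quadratic_error (g : R -> R) (d C x : R) :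
  (forall e, `|g (x + e) - g x - e * d| <= C * e ^+ 2) ->
  is_derive x (1 : R) g d.
Proof.
move=> gd.
have C0 : 0 <= C.
  by have := gd 1; rewrite expr1n mulr1; apply: le_trans.
have lim : h^-1 *: (g (h *: 1 + x) - g x) @[h --> (0 : R)^'] --> d.
  apply/cvgrPdist_le => eps eps0.
  have C1 : 0 < C + 1 by lra.
  near=> e.
  have e0 : e != 0 by near: e; exact: nbhs_dnbhs_neq.
  have ee : `|e| <= eps / (C + 1).
    by near: e; apply: dnbhs0_le; rewrite divr_gt0.
  rewrite distrC /GRing.scale/= mulr1.
  have -> : e^-1 * (g (e + x) - g x) - d =
      e^-1 * (g (x + e) - g x - e * d).
    by rewrite [e + x]addrC; field.
  rewrite normrM normfV ler_pdivrMl ?normr_gt0//.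
  apply: le_trans (gd e) _.
  rewrite -real_normK ?num_real// expr2 mulrCA ler_wpM2l//.
  apply: le_trans (_ : C * (eps / (C + 1)) <= _); first by rewrite ler_wpM2l.
  by rewrite mulrA ler_pdivrMr// mulrC ler_wpM2l ?(ltW eps0)//; lra.
apply: DeriveDef; last exact/cvg_lim.
by apply/cvg_ex; exists d.
Unshelve. all: by end_near. Qed.

Lemma is_derive_affine (g : R -> R) (a b x d : R) :
  is_derive (a * x + b) (1 : R) g d ->
  is_derive x (1 : R) (fun z => g (a * z + b)) (d * a).
Proof.
move=> gd; apply: (@is_derive1_comp R g (fun z => a * z + b)).
have -> : (fun z => a * z + b) = a \*: id + cst b by [].
by apply: is_derive_eq; rewrite /GRing.scale/= mulr1 addr0.
Qed.

Lemma is_derive_subZ (f g : R -> R) (c x df dg : R) :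
  is_derive x (1 : R) f df -> is_derive x (1 : R) g dg ->
  is_derive x (1 : R) (fun z => f z - c * g z) (df - c * dg).
Proof.
move=> ? ?.
have -> : (fun z => f z - c * g z) = f - c \*: g by [].
by apply: is_derive_eq.
Qed.

Lemma is_derive_lin3 (f g k : R -> R) (a b c x df dg dk : R) :
  is_derive x (1 : R) f df -> is_derive x (1 : R) g dg ->
  is_derive x (1 : R) k dk ->
  is_derive x (1 : R) (fun z => a * (f z - b * g z + c * k z))
    (a * (df - b * dg + c * dk)).
Proof.
move=> ? ? ?.
have -> : (fun z => a * (f z - b * g z + c * k z)) =
  a \*: (f - b \*: g + c \*: k) by [].
by apply: is_derive_eq.
Qed.

Lemma is_derive_affine_add (K : R -> R) (k c d s : R) :
  is_derive s (1 : R) K d ->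
  is_derive s (1 : R) (fun z => K z + k * z + c) (d + k).
Proof.
move=> dK; have -> : (fun z => K z + k * z + c) = K + k \*: id + cst c by [].
by apply: is_derive_eq; rewrite /GRing.scale/= mulr1 addr0.
Qed.

Lemma is_derive_parabola (a c : R) :
  is_derive (0 : R) (1 : R) (fun e => e ^+ 2 + a * e + c) a.
Proof.
apply: (@is_derive_quadratic_error _ _ 1) => e.
rewrite (_ : _ - _ - _ = e ^+ 2); last by ring.
by rewrite mul1r ger0_norm ?sqr_ge0.
Qed.

Lemma derivable1_continuous (g g1 : R -> R) :
  (forall s, is_derive s (1 : R) g (g1 s)) -> continuous g.
Proof.
move=> dg s; apply/differentiable_continuous/derivable1_diffP.
by have [] := dg s.
Qed.

(** A directional derivative only sees the restriction of the function to a
    line, which reduces all space-time derivatives below to one variable. *)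
Lemma is_derive_line (V : normedModType R) (f : V -> R) (a v : V) (d : R) :
  is_derive (0 : R) (1 : R) (fun e : R => f (e *: v + a)) d ->
  is_derive a v f d.
Proof.
have E : (fun e : R => e^-1 *: (((fun e : R => f (e *: v + a)) \o shift 0)
      (e *: (1 : R)) - f ((0 : R) *: v + a))) =
    (fun e : R => e^-1 *: ((f \o shift a) (e *: v) - f a)).
  by apply/funext => e /=; rewrite scale0r add0r addr0 /GRing.scale/= mulr1.
move=> [df <-]; apply: DeriveDef.
  by move: df; rewrite /derivable E.
by rewrite /derive E.
Qed.

Lemma line_cvg (V : normedModType R) (a v : V) :
  (fun e : R => e *: v + a) @ (0 : R) --> a.
Proof.
rewrite -[in X in _ --> X](add0r a) -[in X in _ --> X](scale0r v).
by apply: cvgD; [apply: cvgZr_tmp; exact: cvg_id|exact: cvg_cst].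
Qed.

End Derivatives.

(** * A twice continuously differentiable step *)

Section PositivePart.
Variable R : realType.
Implicit Types x : R.

Definition pos x : R := Num.max 0 x.

Lemma pos_ge0 x : 0 <= pos x.
Proof. by rewrite /pos le_max lexx. Qed.

Lemma pos_id x : 0 <= x -> pos x = x.
Proof. exact: max_r. Qed.

Lemma pos_eq0 x : x <= 0 -> pos x = 0.
Proof. exact: max_l. Qed.

Lemma pos_continuous : continuous pos.
Proof. by move=> x; apply: continuous_max; [exact: cvg_cst|exact: cvg_id]. Qed.

Global Instance is_derive_pos_sqr x :
  is_derive x (1 : R) (fun z => pos z ^+ 2) (2 * pos x).
Proof.
apply: (@is_derive_quadratic_error _ _ _ 1) => e; rewrite mul1r /pos.
have sq := sqr_ge0 (x + e); have sqe := sqr_ge0 e.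
rewrite ler_norml; case: (lerP 0 x) => x0; case: (lerP 0 (x + e)) => xe;
  rewrite ?expr0n/= ?mulr0 ?mul0r ?subr0.
- by apply/andP; split; lra.
- have := mulr_ge0 x0 (ltW (_ : 0 < - (x + e))); rewrite oppr_gt0 => /(_ xe).
  by move=> ?; apply/andP; split; nra.
- have := mulr_ge0 (ltW (_ : 0 < - x)) (xe); rewrite oppr_gt0 => /(_ x0).
  by move=> ?; apply/andP; split; nra.
- by apply/andP; split; lra.
Qed.

Global Instance is_derive_pos_cube x :
  is_derive x (1 : R) (fun z => pos z ^+ 3) (3 * pos x ^+ 2).
Proof.
have -> : (fun z => pos z ^+ 3) = (id : R -> R) * (fun z => pos z ^+ 2).
  apply/funext => z; rewrite /GRing.mul/= /pos.
  by case: (lerP 0 z) => _; ring.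
apply: is_derive_eq; rewrite /GRing.scale/= /pos.
by case: (lerP 0 x) => _; ring.
Qed.

(** [step2] is the tent of height 2 on [0, 1]; [step1] and [step] are its first
    and second primitives. So [step1] climbs from 0 to 1 on [0, 1], and [step]
    turns from 0 into a line of slope 1 while remaining of class C^2. *)
Definition step x : R := 2 / 3 * (pos x ^+ 3 - 2 * pos (x - 1 / 2) ^+ 3
  + pos (x - 1) ^+ 3).
Definition step1 x : R := 2 * (pos x ^+ 2 - 2 * pos (x - 1 / 2) ^+ 2
  + pos (x - 1) ^+ 2).
Definition step2 x : R := 4 * (pos x - 2 * pos (x - 1 / 2) + pos (x - 1)).

Lemma is_derive_step x : is_derive x (1 : R) step (step1 x).
Proof.
have shifted (c : R) := @is_derive_affine _ (fun z => pos z ^+ 3) 1 c x _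
  (is_derive_pos_cube _).
have := is_derive_lin3 (2 / 3) 2 1 (is_derive_pos_cube x) (shifted (- (1 / 2)))
  (shifted (- 1)).
have -> : (fun z : R => 2 / 3 * (pos z ^+ 3 - 2 * pos (1 * z + - (1 / 2)) ^+ 3 +
    1 * pos (1 * z + - 1) ^+ 3)) = step.
  by apply/funext => z; rewrite /step /step1 !mul1r.
by move=> /is_derive_eq; apply; rewrite /step1 !mul1r; field.
Qed.

Lemma is_derive_step1 x : is_derive x (1 : R) step1 (step2 x).
Proof.
have shifted (c : R) := @is_derive_affine _ (fun z => pos z ^+ 2) 1 c x _
  (is_derive_pos_sqr _).
have := is_derive_lin3 2 2 1 (is_derive_pos_sqr x) (shifted (- (1 / 2)))
  (shifted (- 1)).
have -> : (fun z : R => 2 * (pos z ^+ 2 - 2 * pos (1 * z + - (1 / 2)) ^+ 2 +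
    1 * pos (1 * z + - 1) ^+ 2)) = step1.
  by apply/funext => z; rewrite /step /step1 !mul1r.
by move=> /is_derive_eq; apply; rewrite /step2 !mul1r; field.
Qed.

Lemma step2_continuous : continuous step2.
Proof.
move=> x; apply: cvgM; first exact: cvg_cst.
have shifted (c : R) : {for x, continuous (fun z => pos (z - c))}.
  apply: continuous_comp; last exact: pos_continuous.
  by apply: cvgB; [exact: cvg_id|exact: cvg_cst].
apply: cvgD; last exact: shifted.
apply: cvgB; first exact: pos_continuous.
by apply: cvgM; [exact: cvg_cst|exact: shifted].
Qed.

Lemma step_le0 x : x <= 0 -> [/\ step x = 0, step1 x = 0 & step2 x = 0].
Proof.
move=> x0; rewrite /step /step1 /step2 !pos_eq0; try lra.
by split; ring.
Qed.

Lemma step_ge1 x : 1 <= x -> [/\ step x = x - 1 / 2, step1 x = 1 & step2 x = 0].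
Proof.
move=> x0; rewrite /step /step1 /step2 !pos_id; try lra.
by split; field.
Qed.

Lemma step_bounds x :
  [/\ 0 <= step x <= pos x, x - 1 <= step x,
      0 <= step1 x <= 1 & 0 <= step2 x <= 2].
Proof.
have [x0|x0] := lerP x 0.
  have [-> -> ->] := step_le0 x0; rewrite pos_eq0//.
  by split; try (apply/andP; split); lra.
have [x1|x1] := lerP 1 x.
  have [-> -> ->] := step_ge1 x1; rewrite pos_id; last lra.
  by split; try (apply/andP; split); lra.
rewrite /step /step1 /step2 (@pos_id x) ?(@pos_eq0 (x - 1)); try lra.
have [xh|xh] := lerP x (1 / 2).
  rewrite !pos_eq0; try lra.
  have x2 : 0 <= x ^+ 2 <= x / 2 by rewrite sqr_ge0/=; nra.
  have x3 : 0 <= x ^+ 3 <= x / 4 by rewrite exprS; apply/andP; split; nra.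
  by rewrite !expr0n/=; split; try (apply/andP; split); lra.
rewrite !pos_id; try lra.
pose y := 1 - x.
have -> : x = 1 - y by rewrite /y; ring.
have y0 : 0 < y by rewrite /y; lra.
have yh : y < 1 / 2 by rewrite /y; lra.
have y2 : 0 <= y ^+ 2 <= y / 2 by rewrite sqr_ge0/=; nra.
have y3 : 0 <= y ^+ 3 <= y / 4 by rewrite exprS; apply/andP; split; nra.
have -> : (1 - y) ^+ 3 - 2 * (1 - y - 1 / 2) ^+ 3 =
  3 / 4 - 3 / 2 * y + y ^+ 3 by field.
have -> : (1 - y) ^+ 2 - 2 * (1 - y - 1 / 2) ^+ 2 = 1 / 2 - y ^+ 2 by field.
by rewrite !expr0n/=; split; try (apply/andP; split); lra.
Qed.

End PositivePart.

(** * The integral condition in dyadic form *)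

Section DyadicSums.
Variables (R : realType) (h : R -> R).
Hypothesis h_gt0 : forall s : R, 0 < s -> 0 < h s.
Hypothesis h_nondec : forall s t : R, 0 < s -> s <= t -> h s <= h t.
Hypothesis h_int :
  (\int[lebesgue_measure]_(s in `[1%R, +oo[) ((s * h s)^-1)%:E < +oo)%E.

Let w (s : R) : R := (s * h s)^-1.

Lemma weight_anti (s t : R) : 0 < s -> s <= t -> w t <= w s.
Proof.
move=> s0 st; have t0 := lt_le_trans s0 st.
rewrite /w lef_pV2 ?posrE ?mulr_gt0 ?h_gt0//.
by rewrite ler_pM ?(ltW s0) ?(ltW (h_gt0 _))// h_nondec.
Qed.

Lemma weight_measurable :
  measurable_fun (`[1%R, +oo[%classic : set R)
    (EFin \o w).
Proof.
apply/measurable_EFinP.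
apply: (eq_measurable_fun (fun s : R => w (Num.max 1 s))).
  by move=> s; rewrite inE/= in_itv/= andbT => s1; rewrite max_r.
apply: nonincreasing_measurable => // s t st.
by apply: weight_anti; rewrite ?lt_max ?ltr01// ge_max !le_max lexx st orbT.
Qed.

(** Cauchy condensation: on [2^k, 2^(k+1)] the weight is at least its value at
    the right end, and the length 2^k cancels the factor 2^(k+1) up to 2. *)
Lemma dyadic_sum_le_integral N :
  ((\sum_(k < N) (2 * h (2 ^+ k.+1))^-1)%:E <=
    \int[lebesgue_measure]_(s in `[1%R, (2 ^+ N)%R[) (w s)%:E)%E.
Proof.
have one_le_pow k : 1 <= (2 : R) ^+ k by rewrite exprn_ege1// ler1n.
have sub (a b : itv_bound R) : (BLeft 1%R <= a)%O ->
    [set` Interval a b] `<=` `[1%R, +oo[%classic.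
  move=> a1 s /=; rewrite !itv_boundlr => /andP[as_ _].
  by rewrite (le_trans a1 as_).
elim: N => [|N IH].
  by rewrite big_ord0 expr0 set_itvco0 integral_set0.
have mw (a b : itv_bound R) : (BLeft 1%R <= a)%O ->
    measurable_fun ([set` Interval a b] : set R) (EFin \o w).
  move=> a1; apply: measurable_funS weight_measurable => //; exact: sub.
have w0 (a b : itv_bound R) : (BLeft 1%R <= a)%O ->
    forall s, [set` Interval a b] s -> (0 <= (w s)%:E)%E.
  move=> a1 s /(sub _ _ a1) /=; rewrite in_itv/= andbT => s1.
  have s0 : 0 < s by rewrite (lt_le_trans ltr01).
  by rewrite lee_fin invr_ge0 ltW// mulr_gt0 ?h_gt0.
rewrite (@itv_bndbnd_setU _ _ _ (BLeft (2 ^+ N))); last 2 first.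
- by rewrite bnd_simp.
- by rewrite bnd_simp ler_eXn2l ?ltr1n.
have sub2 (s : R) : `[1%R, (2 ^+ N)%R[%classic s \/
    `[(2 ^+ N)%R, (2 ^+ N.+1)%R[%classic s -> `[1%R, +oo[%classic s.
  by case; apply: sub; rewrite bnd_simp.
rewrite ge0_integral_setU//=; last 3 first.
- by apply: measurable_funS weight_measurable.
- by move=> s /sub2; apply: (w0 (BLeft 1%R) +oo%O); rewrite bnd_simp.
- apply/disj_setPS => s /=; rewrite !in_itv/= => -[/andP[_ a] /andP[b _]].
  by move: (lt_le_trans a b); rewrite ltxx.
rewrite big_ord_recr/= EFinD leeD//.
have N0 : 0 < (2 : R) ^+ N by rewrite exprn_gt0.
have -> : ((2 * h (2 ^+ N.+1))^-1)%:E =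
    (\int[lebesgue_measure]_(s in `[(2 ^+ N)%R, (2 ^+ N.+1)%R[)
      (w (2 ^+ N.+1))%:E)%E.
  rewrite integral_cst//= lebesgue_measure_itv/= lte_fin ltr_eXn2l ?ltr1n//=.
  rewrite ltnSn -EFinD -EFinM; congr EFin; rewrite /w exprS.
  have hN : 0 < h (2 * 2 ^+ N) by rewrite h_gt0// mulr_gt0.
  by field; rewrite !gt_eqF.
apply: ge0_le_integral => //=.
- by move=> s _; apply: (w0 (BLeft 1%R) +oo%O) => //=; rewrite in_itv/= andbT.
- by apply: mw; rewrite bnd_simp.
- move=> s; rewrite in_itv/= => /andP[a b]; rewrite lee_fin weight_anti ?ltW//.
  by rewrite (lt_le_trans N0).
Qed.

(** The integral condition enters the proof only through this tail, which bounds
    the total height gained by the steep part of the barrier profile. *)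
Lemma dyadic_tail_small (eps : R) : 0 < eps ->
  exists j0, forall j N, (j0 <= j)%N ->
    \sum_(k < N) (h (2 ^+ (j + k)))^-1 <= eps.
Proof.
move=> eps0.
pose a k := (2 * h (2 ^+ k.+1))^-1.
pose sm N := \sum_(k < N) a k.
have a0 k : 0 <= a k by rewrite invr_ge0 mulr_ge0 ?ltW ?h_gt0 ?exprn_gt0.
have := h_int; set J := (\int[lebesgue_measure]_(s in _) _)%E => Jfin.
have smJ N : ((sm N)%:E <= J)%E.
  apply: le_trans (dyadic_sum_le_integral N) _.
  apply: ge0_subset_integral => //=.
  - exact: weight_measurable.
  - move=> s /=; rewrite in_itv/= andbT => s1.
    have s0 : 0 < s by rewrite (lt_le_trans ltr01).
    by rewrite lee_fin invr_ge0 ltW// mulr_gt0 ?h_gt0.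
  - by move=> s /=; rewrite !in_itv/= => /andP[->].
pose E := [set sm N | N in setT].
have J0 : (0 <= J)%E by have := smJ 0%N; rewrite /sm big_ord0.
have supE : has_sup E.
  split; first by exists (sm 0%N), 0%N.
  exists (fine J) => _ [N _ <-]; rewrite -lee_fin fineK ?smJ//.
  by rewrite ge0_fin_numE.
have [_ [j0 _ <-] j0P] := sup_adherent (divr_gt0 eps0 (ltr0Sn R 1)) supE.
exists j0.+1 => j N jj.
have [i ji] : exists i, j = (j0 + i).+1.
  by exists (j - j0.+1)%N; rewrite -addSn subnKC.
have smS : sm (j0 + i + N)%N = sm (j0 + i)%N + \sum_(k < N) a (j0 + i + k)%N.
  elim: N => [|N IH]; first by rewrite big_ord0 addr0 addn0.
  by rewrite addnS /sm !big_ord_recr/= -/(sm _) IH addrA.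
have smi : sm j0 <= sm (j0 + i)%N.
  elim: (i) => [|i' IH]; first by rewrite addn0.
  by rewrite addnS /sm big_ord_recr/= (le_trans IH)// lerDl.
have := sup_upper_bound supE; move=> /(_ (sm (j0 + i + N)%N)) smsup.
have {}smsup := smsup (ex_intro2 _ _ _ I erefl).
have -> : \sum_(k < N) (h (2 ^+ (j + k)))^-1 =
    2 * \sum_(k < N) a (j0 + i + k)%N.
  rewrite mulr_sumr; apply: eq_bigr => k _.
  by rewrite /a ji addSn invfM mulrA divff ?mul1r// pnatr_eq0.
lra.
Qed.

End DyadicSums.

(** * A concave profile with geometrically growing slopes *)

(** The slope of [profile N] is a C^1 substitute for a solution p of
    p' = c p^2 h(p) that blows up at [Q]. It starts at [m] and is doubled [N]
    times; the doubling number [k] happens at distance between [r k / 2] and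
    [r k] from [Q]. Since [r k.+1 <= r k / 2], the doublings do not overlap, so
    the size of the slope is known while it is growing. *)

Section Profile.
Variables (R : realType) (m Q : R) (r : nat -> R).
Hypothesis m_gt0 : 0 < m.
Hypothesis r_gt0 : forall k, 0 < r k.
Hypothesis r_half : forall k, r k.+1 <= r k / 2.

Let p k : R := 2 ^+ k * m.

Definition ramp k (s : R) : R := 2 / r k * s + 2 / r k * (r k - Q).

Definition profile N (s : R) : R :=
  m * (Q - s) - 1 / 2 - \sum_(k < N) p k * (r k / 2) * step (ramp k s).
Definition slope N (s : R) : R := m + \sum_(k < N) p k * step1 (ramp k s).
Definition curvature N (s : R) : R :=
  \sum_(k < N) p k * (2 / r k) * step2 (ramp k s).

Lemma level_gt0 k : 0 < p k.
Proof. by rewrite mulr_gt0// exprn_gt0. Qed.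

Lemma profileS N s : profile N.+1 s =
  profile N s - p N * (r N / 2) * step (ramp N s).
Proof. by rewrite /profile big_ord_recr/=; ring. Qed.

Lemma slopeS N s : slope N.+1 s = slope N s + p N * step1 (ramp N s).
Proof. by rewrite /slope big_ord_recr/= addrA. Qed.

Lemma curvatureS N s : curvature N.+1 s =
  curvature N s + p N * (2 / r N) * step2 (ramp N s).
Proof. by rewrite /curvature big_ord_recr. Qed.

Lemma is_derive_profile N s :
  is_derive s (1 : R) (profile N) (- slope N s).
Proof.
elim: N => [|N IH].
  have -> : profile 0 = cst (m * Q - 1 / 2) - m \*: id.
    apply/funext => z; rewrite /profile big_ord0.
    by rewrite -[RHS]/(m * Q - 1 / 2 - m * z); ring.
  by apply: is_derive_eq; rewrite /slope big_ord0 /GRing.scale/=; ring.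
have -> : profile N.+1 = fun z =>
    profile N z - p N * (r N / 2) * step (ramp N z).
  by apply/funext => z; rewrite profileS.
have dramp := is_derive_affine (is_derive_step (ramp N s)).
apply: (is_derive_eq (is_derive_subZ (p N * (r N / 2)) IH dramp)).
have rN : r N != 0 by rewrite gt_eqF.
by rewrite slopeS /ramp; field.
Qed.

Lemma is_derive_slope N s :
  is_derive s (1 : R) (slope N) (curvature N s).
Proof.
elim: N => [|N IH].
  have -> : slope 0 = cst m.
    by apply/funext => z; rewrite /slope big_ord0 addr0.
  by apply: is_derive_eq; rewrite /curvature big_ord0.
have -> : slope N.+1 = fun z => slope N z - (- p N) * step1 (ramp N z).
  by apply/funext => z; rewrite slopeS; ring.
have dramp := is_derive_affine (is_derive_step1 (ramp N s)).
apply: (is_derive_eq (is_derive_subZ (- p N) IH dramp)).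
by rewrite curvatureS /ramp; ring.
Qed.

Lemma curvature_continuous N : continuous (curvature N).
Proof.
elim: N => [|N IH] s.
  rewrite (_ : curvature 0 = cst 0); first exact: cvg_cst.
  by apply/funext => z; rewrite /curvature big_ord0.
rewrite (_ : curvature N.+1 = fun z =>
  curvature N z + p N * (2 / r N) * step2 (ramp N z)); last first.
  by apply/funext => z; rewrite curvatureS.
apply: cvgD; first exact: IH.
apply: cvgM; first exact: cvg_cst.
apply: continuous_comp; last exact: step2_continuous.
apply: cvgD; last exact: cvg_cst.
by apply: cvgM; [exact: cvg_cst|exact: cvg_id].
Qed.

Lemma slope_ge N s : m <= slope N s.
Proof.
elim: N => [|N IH]; first by rewrite /slope big_ord0 addr0.
rewrite slopeS (le_trans IH)// lerDl mulr_ge0 ?(ltW (level_gt0 _))//.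
by have [_ _ /andP[]] := step_bounds (ramp N s).
Qed.

Lemma curvature_ge0 N s : 0 <= curvature N s.
Proof.
elim: N => [|N IH]; first by rewrite /curvature big_ord0.
rewrite curvatureS addr_ge0// mulr_ge0//; last first.
  by have [_ _ _ /andP[]] := step_bounds (ramp N s).
by rewrite mulr_ge0 ?divr_ge0 ?ltW ?level_gt0.
Qed.

Lemma ramp_le0 k s : s <= Q - r k -> ramp k s <= 0.
Proof.
move=> sQ; rewrite /ramp -mulrDr pmulr_rle0 ?divr_gt0//; lra.
Qed.

Lemma ramp_ge1 k s : Q - r k / 2 <= s -> 1 <= ramp k s.
Proof.
move=> sQ; rewrite /ramp -mulrDr -mulrA mulrCA ler_pdivlMl// mulr1; lra.
Qed.

Lemma slope_before N s : s <= Q - r 0 ->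
  slope N s = m /\ curvature N s = 0.
Proof.
move=> sQ.
have r_dec k : r k <= r 0.
  by elim: k => // k; have := r_half k; have := r_gt0 k; lra.
elim: N => [|N [IH1 IH2]].
  by rewrite /slope /curvature !big_ord0 addr0.
have /step_le0[_ s1 s2] : ramp N s <= 0.
  by apply: ramp_le0; have := r_dec N; lra.
by rewrite slopeS curvatureS IH1 IH2 s1 s2 !mulr0 !addr0.
Qed.

Lemma slope_after N s : Q - r N <= s -> slope N s = p N /\ curvature N s = 0.
Proof.
elim: N s => [|N IH] s sQ.
  by rewrite /slope /curvature !big_ord0 /p mul1r addr0.
have rN := r_half N; have rN0 := r_gt0 N.
have [|IH1 IH2] := IH s; first by lra.
have /step_ge1[_ s1 s2] : 1 <= ramp N s by apply: ramp_ge1; lra.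
rewrite slopeS curvatureS IH1 IH2 s1 s2 mulr0 addr0 mulr1 /p exprS.
by split; ring.
Qed.

(** The differential inequality behind the profile: at every point at most one
    doubling is active, and there the slope is at least [p k] while its growth
    is at most [4 * p k / r k]. *)
Lemma curvature_le (g : R -> R) N s :
  (forall x y, m <= x -> x <= y -> g x <= g y) -> 0 <= g m ->
  (forall k, 4 * p k / r k <= g (p k)) ->
  curvature N s <= g (slope N s).
Proof.
move=> g_nondec g0 gr; elim: N => [|N IH].
  by rewrite /curvature /slope !big_ord0 addr0.
have [sQ|sQ] := lerP s (Q - r N).
  have /step_le0[_ s1 s2] := ramp_le0 sQ.
  by rewrite slopeS curvatureS s1 s2 !mulr0 !addr0.
have [eS eC] := slope_after (ltW sQ).
have [_ _ /andP[s10 _] /andP[_ s22]] := step_bounds (ramp N s).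
rewrite slopeS curvatureS eS eC add0r.
apply: le_trans (_ : g (p N) <= _); last first.
  apply: g_nondec; first by rewrite -eS slope_ge.
  by rewrite lerDl mulr_ge0// ltW// level_gt0.
apply: le_trans (gr N).
have -> : 4 * p N / r N = p N * (2 / r N) * 2 by ring.
by rewrite ler_wpM2l// mulr_ge0 ?divr_ge0 ?ltW ?level_gt0.
Qed.

Lemma profile_le N s : profile N s <= m * (Q - s) - 1 / 2.
Proof.
rewrite /profile lerBlDr lerDl sumr_ge0// => k _.
have [/andP[st _] _ _ _] := step_bounds (ramp k s).
by rewrite mulr_ge0// mulr_ge0 ?divr_ge0 ?ltW ?level_gt0.
Qed.

(** Doubling number [k] costs at most [p k * r k] in height. When these costs are
    summable, the slope becomes arbitrarily large near [Q] while the height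
    stays bounded in [N]. *)
Lemma profile_end N : \sum_(k < N) p k * r k <= 1 / 2 -> - 1 <= profile N Q.
Proof.
move=> sm; rewrite /profile subrr mulr0 sub0r.
suff : \sum_(k < N) p k * (r k / 2) * step (ramp k Q) <= \sum_(k < N) p k * r k.
  lra.
apply: ler_sum => k _.
have [/andP[_ st] _ _ _] := step_bounds (ramp k Q).
have rQ : ramp k Q = 2.
  have rk : r k != 0 by rewrite gt_eqF.
  by rewrite /ramp; field.
rewrite rQ pos_id ?ler0n// in st.
rewrite rQ; have -> : p k * r k = p k * (r k / 2) * 2 by field.
by rewrite ler_wpM2l// mulr_ge0 ?divr_ge0 ?ltW ?level_gt0.
Qed.

(** Past [Q] the profile falls with its final slope: this is what brings a
    barrier shifted by a small length down to negative values. *)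
Lemma profile_beyond N x : 0 <= x ->
  profile N (Q + x) <= - (p N * x) - 1 / 2.
Proof.
move=> x0; elim: N => [|N IH].
  by rewrite /profile big_ord0 /p expr0; lra.
rewrite profileS.
have [_ st _ _] := step_bounds (ramp N (Q + x)).
have rN := r_gt0 N.
have : p N * (r N / 2) * (ramp N (Q + x) - 1) <=
    p N * (r N / 2) * step (ramp N (Q + x)).
  by rewrite ler_wpM2l// mulr_ge0 ?divr_ge0 ?ltW ?level_gt0.
have -> : p N * (r N / 2) * (ramp N (Q + x) - 1) = p N * x + p N * (r N / 2).
  have rk : r N != 0 by rewrite gt_eqF.
  by rewrite /ramp; field.
have : 0 <= p N * (r N / 2) by rewrite mulr_ge0 ?divr_ge0 ?ltW ?level_gt0.
have -> : p N.+1 = 2 * p N by rewrite /p exprS mulrA.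
lra.
Qed.

End Profile.

(** * Radial functions and their space-time derivatives *)

Section RadialTest.
Variables (R : realType) (n : nat) (y : 'rV[R]_n).
Variables (G G1 G2 b b1 : R -> R) (A s0 : R).
Hypothesis dG : forall s, is_derive s (1 : R) G (G1 s).
Hypothesis dG1 : forall s, is_derive s (1 : R) G1 (G2 s).
Hypothesis G2_cont : continuous G2.
Hypothesis db : forall t, is_derive t (1 : R) b (b1 t).
Hypothesis b1_cont : continuous b1.

Implicit Types w : 'rV[R]_n * R.

Definition dist2 (x : 'rV[R]_n) : R := \sum_(i < n) (x 0 i - y 0 i) ^+ 2.

(** Using the squared distance as radial variable keeps these functions smooth
    at the centre [y]. The drift [A * t * (q - s0)] makes the function decrease
    in time near the centre and increase far from it. *)
Definition radial_test w : R :=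
  G (dist2 w.1) + A * w.2 * (dist2 w.1 - s0) - b w.2.

(** The derivative of [radial_test] with respect to the squared distance. *)
Definition radial_slope w : R := G1 (dist2 w.1) + A * w.2.

Lemma dist2_line (e : R) (i : 'I_n) (x : 'rV[R]_n) :
  dist2 (e *: delta_mx 0 i + x) =
  e ^+ 2 + 2 * (x 0 i - y 0 i) * e + dist2 x.
Proof.
rewrite /dist2 (bigD1 i)//= [in RHS](bigD1 i)//=.
have -> : \sum_(j < n | j != i) ((e *: delta_mx 0 i + x) 0 j - y 0 j) ^+ 2 =
    \sum_(j < n | j != i) (x 0 j - y 0 j) ^+ 2.
  by apply: eq_bigr => j ji; rewrite !mxE eqxx (negbTE ji) mulr0 add0r.
by rewrite !mxE !eqxx mulr1; ring.
Qed.

Lemma is_derive_radial_comp (K K1 : R -> R) (x : 'rV[R]_n) (i : 'I_n) :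
  (forall s, is_derive s (1 : R) K (K1 s)) ->
  is_derive (0 : R) (1 : R) (fun e => K (dist2 (e *: delta_mx 0 i + x)))
    (K1 (dist2 x) * (2 * (x 0 i - y 0 i))).
Proof.
move=> dK; have -> : (fun e => K (dist2 (e *: delta_mx 0 i + x))) =
    K \o (fun e => e ^+ 2 + 2 * (x 0 i - y 0 i) * e + dist2 x).
  by apply/funext => e /=; rewrite dist2_line.
apply: is_derive1_comp; last exact: is_derive_parabola.
by rewrite expr0n/= mulr0 !add0r.
Qed.

Lemma is_derive_test_x w (i : 'I_n) :
  is_derive w (dir_x R i) radial_test
    (2 * (w.1 0 i - y 0 i) * radial_slope w).
Proof.
apply: is_derive_line.
have dK s := is_derive_affine_add (A * w.2) (- (A * w.2 * s0) - b w.2) (dG s).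
have -> : (fun e => radial_test (e *: dir_x R i + w)) = fun e =>
    (fun z => G z + A * w.2 * z + (- (A * w.2 * s0) - b w.2))
      (dist2 (e *: delta_mx 0 i + w.1)).
  apply/funext => e; rewrite /radial_test /= scaler0 add0r; ring.
by apply: (is_derive_eq (is_derive_radial_comp w.1 i dK)); rewrite mulrC.
Qed.

Lemma is_derive_test_xx w (i j : 'I_n) :
  is_derive w (dir_x R i) (fun z => 2 * (z.1 0 j - y 0 j) * radial_slope z)
    (2 * (i == j)%:R * radial_slope w +
     4 * G2 (dist2 w.1) * (w.1 0 i - y 0 i) * (w.1 0 j - y 0 j)).
Proof.
apply: is_derive_line.
have dK s := is_derive_affine_add 0 (A * w.2) (dG1 s).
have dS := is_derive_radial_comp w.1 i dK.
pose coord (e : R) := 2 * (i == j)%:R * e + 2 * (w.1 0 j - y 0 j).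
have dcoord : is_derive (0 : R) (1 : R) coord (2 * (i == j)%:R).
  have -> : coord = (2 * (i == j)%:R) \*: id + cst (2 * (w.1 0 j - y 0 j)) by [].
  by apply: is_derive_eq; rewrite /GRing.scale/= mulr1 addr0.
have -> : (fun e => 2 * ((e *: dir_x R i + w).1 0 j - y 0 j) *
      radial_slope (e *: dir_x R i + w)) =
    coord * (fun e => (fun z => G1 z + 0 * z + A * w.2)
      (dist2 (e *: delta_mx 0 i + w.1))).
  apply/funext => e; rewrite -[RHS]/(coord e * (G1 _ + 0 * _ + A * w.2)).
  rewrite /radial_slope /coord /= scaler0 add0r !mxE eqxx/= [j == i]eq_sym; ring.
apply: (is_derive_eq (is_deriveM dcoord dS)).
rewrite /= scale0r add0r /coord /radial_slope.
by rewrite -[_ *: (_ * _)]/(_ * (_ * _)) -[_ *: (2 * _)]/(_ * (2 * _)); ring.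
Qed.

Lemma is_derive_test_t w :
  is_derive w (dir_t R n) radial_test (A * (dist2 w.1 - s0) - b1 w.2).
Proof.
apply: is_derive_line.
have drift := is_derive_affine_add (A * (dist2 w.1 - s0))
  (G (dist2 w.1) + A * w.2 * (dist2 w.1 - s0)) (is_derive_cst (0 : R) (0 : R) 1).
have dbt := @is_derive_affine _ b 1 w.2 0 _ (db (1 * 0 + w.2)).
have -> : (fun e => radial_test (e *: dir_t R n + w)) = fun e =>
    (fun s => cst 0 s + A * (dist2 w.1 - s0) * s +
       (G (dist2 w.1) + A * w.2 * (dist2 w.1 - s0))) e - 1 * b (1 * e + w.2).
  by apply/funext => e; rewrite /radial_test /= scaler0 add0r !mul1r
    -[e%:A]/(e * 1) mulr1; ring.
apply: (is_derive_eq (is_derive_subZ 1 drift dbt)).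
by rewrite mulr0 !add0r mulr1 mul1r.
Qed.

Lemma dx_radial_test (i : 'I_n) : dx i radial_test =
  fun z => 2 * (z.1 0 i - y 0 i) * radial_slope z.
Proof. by apply/funext => z; have [_] := is_derive_test_x z i. Qed.

Lemma dt_radial_test : dt radial_test =
  fun z => A * (dist2 z.1 - s0) - b1 z.2.
Proof. by apply/funext => z; have [_] := is_derive_test_t z. Qed.

Lemma dxx_radial_test (i j : 'I_n) : dx i (dx j radial_test) = fun z =>
  2 * (i == j)%:R * radial_slope z +
  4 * G2 (dist2 z.1) * (z.1 0 i - y 0 i) * (z.1 0 j - y 0 j).
Proof.
by apply/funext => z; rewrite dx_radial_test; have [_] := is_derive_test_xx z i j.
Qed.

Lemma coord_fst_continuous (i : 'I_n) :
  continuous (fun z : 'rV[R]_n * R => z.1 0 i).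
Proof.
move=> z; apply: (@continuous_comp _ _ _ fst (fun x : 'rV[R]_n => x 0 i)).
  exact: cvg_fst.
exact: coord_continuous.
Qed.

Lemma coord_sub_continuous (i : 'I_n) :
  continuous (fun z : 'rV[R]_n * R => z.1 0 i - y 0 i).
Proof. by move=> z; apply: cvgB; [exact: coord_fst_continuous|exact: cvg_cst]. Qed.

Lemma dist2_continuous : continuous dist2.
Proof.
apply: continuous_big => [z|i _ x].
  by apply: cvgD; [exact: cvg_fst|exact: cvg_snd].
apply: (@continuous_comp _ _ _ (fun z : 'rV[R]_n => z 0 i - y 0 i)
  (fun e : R => e ^+ 2)); last exact: exprn_continuous.
by apply: continuousB; [exact: coord_continuous|exact: cst_continuous].
Qed.

Lemma dist2_fst_continuous : continuous (fun z : 'rV[R]_n * R => dist2 z.1).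
Proof.
move=> z; apply: (@continuous_comp _ _ _ fst dist2); first exact: cvg_fst.
exact: dist2_continuous.
Qed.

Lemma comp_dist2_continuous (g : R -> R) : continuous g ->
  continuous (fun z : 'rV[R]_n * R => g (dist2 z.1)).
Proof.
move=> gc z; apply: (@continuous_comp _ _ _ (fun z => dist2 z.1) g).
  exact: dist2_fst_continuous.
exact: gc.
Qed.

Lemma comp_snd_continuous (g : R -> R) : continuous g ->
  continuous (fun z : 'rV[R]_n * R => g z.2).
Proof.
move=> gc z; apply: (@continuous_comp _ _ _ snd g); first exact: cvg_snd.
exact: gc.
Qed.

Lemma radial_slope_continuous : continuous radial_slope.
Proof.
move=> z; apply: cvgD.
  exact/comp_dist2_continuous/derivable1_continuous.
by apply: cvgM; [exact: cvg_cst|exact: cvg_snd].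
Qed.

Lemma radial_test_continuous : continuous radial_test.
Proof.
move=> z; apply: cvgB; last exact/comp_snd_continuous/derivable1_continuous.
apply: cvgD; first exact/comp_dist2_continuous/derivable1_continuous.
apply: cvgM; first by apply: cvgM; [exact: cvg_cst|exact: cvg_snd].
by apply: cvgB; [exact: dist2_fst_continuous|exact: cvg_cst].
Qed.

Lemma radial_test_C21 z : C21_near radial_test z.
Proof.
apply: filterE => w; split.
- split; first by have [] := is_derive_test_t w.
  rewrite dt_radial_test; apply: cvgB; last exact: comp_snd_continuous.
  apply: cvgM; first exact: cvg_cst.
  by apply: cvgB; [exact: dist2_fst_continuous|exact: cvg_cst].
- move=> i; split; first by have [] := is_derive_test_x w i.
  rewrite dx_radial_test; apply: cvgM; last exact: radial_slope_continuous.
  by apply: cvgM; [exact: cvg_cst|exact: coord_sub_continuous].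
- move=> i j; split.
    by rewrite dx_radial_test; have [] := is_derive_test_xx w i j.
  rewrite dxx_radial_test; apply: cvgD.
    by apply: cvgM; [exact: cvg_cst|exact: radial_slope_continuous].
  apply: cvgM; last exact: coord_sub_continuous.
  apply: cvgM; last exact: coord_sub_continuous.
  by apply: cvgM; [exact: cvg_cst|exact: comp_dist2_continuous].
Qed.

End RadialTest.

(** * Lower bounds for the elliptic operator on radial functions *)

Section Ellipticity.
Variables (R : realType) (n : nat) (lam Lam : R).
Hypothesis lam_lt : lam < Lam.
Implicit Types (v : 'rV[R]_n) (A X : 'M[R]_n).

Lemma quad_scalar_mx a v :
  (v *m a%:M *m v^T) 0 0 = a * \sum_(i < n) v 0 i ^+ 2.
Proof.
rewrite mul_mx_scalar -scalemxAl mxE; congr (_ * _); rewrite mxE.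
by apply: eq_bigr => i _; rewrite mxE expr2.
Qed.

(** Testing [A <= Lam I] on the standard basis bounds each diagonal entry. *)
Lemma loewner_trace A : loewner_le A Lam%:M -> \tr A <= n%:R * Lam.
Proof.
move=> AL; rewrite -[n in n%:R]card_ord -sumr_const mulr_suml.
apply: ler_sum => i _; rewrite mul1r.
have := AL (delta_mx 0 i); rewrite quad_scalar_mx.
rewrite -rowE trmx_delta -colE !mxE (bigD1 i)//= big1 => [|j ji].
  by rewrite mxE !eqxx addr0 expr1n mulr1.
by rewrite mxE (negbTE ji) andbF expr0n.
Qed.

Lemma pucci_minus_rank_one (s c : R) v : s <= 0 -> c <= 0 ->
  Lam * (s * n%:R + c * \sum_(i < n) v 0 i ^+ 2) <=
  pucci_minus lam Lam (s%:M + c *: (v^T *m v)).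
Proof.
move=> s0 c0; rewrite /pucci_minus; apply: lb_le_inf.
  exists (\tr (lam%:M *m (s%:M + c *: (v^T *m v)))), lam%:M => //; split.
  - by rewrite /symm /= tr_scalar_mx.
  - by move=> w.
  - move=> w; rewrite !quad_scalar_mx ler_wpM2r ?(ltW lam_lt)//.
    by rewrite sumr_ge0// => i _; rewrite sqr_ge0.
move=> _ [A [_ _ AL] <-].
rewrite mulmxDr mxtraceD mul_mx_scalar mxtraceZ -scalemxAr mxtraceZ.
have -> : \tr (A *m (v^T *m v)) = (v *m A *m v^T) 0 0.
  by rewrite mulmxA mxtrace_mulC mulmxA trace_mx11.
have := AL v; rewrite quad_scalar_mx => vA.
have trA := loewner_trace AL.
have := ler_wnM2l s0 trA; have := ler_wnM2l c0 vA; lra.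
Qed.

End Ellipticity.

Section Subsolutions.
Variables (R : realType) (n : nat) (lam Lam : R).
Variables (F : 'M[R]_n -> R) (f : 'rV[R]_n -> R).
Hypothesis lam_lt : lam < Lam.
Hypothesis F0 : F 0 = 0.
Hypothesis ellF : uniformly_elliptic lam Lam F.

Lemma enorm_sqr (x : 'rV[R]_n) : enorm x ^+ 2 = \sum_(i < n) x 0 i ^+ 2.
Proof. by rewrite sqr_sqrtr// sumr_ge0// => i _; rewrite sqr_ge0. Qed.

Lemma enorm_ge0 (x : 'rV[R]_n) : 0 <= enorm x.
Proof. exact: sqrtr_ge0. Qed.

Lemma dist2_enorm (y x : 'rV[R]_n) : dist2 y x = enorm (x - y) ^+ 2.
Proof. by rewrite enorm_sqr; apply: eq_bigr => i _; rewrite !mxE. Qed.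

Section Residual.
Variables (y : 'rV[R]_n) (G G1 G2 b b1 : R -> R) (A s0 : R).
Hypothesis dG : forall s, is_derive s (1 : R) G (G1 s).
Hypothesis dG1 : forall s, is_derive s (1 : R) G1 (G2 s).
Hypothesis db : forall t, is_derive t (1 : R) b (b1 t).

Let phi := radial_test y G b A s0.

Lemma hess_radial_test w :
  hess_x phi w = (2 * radial_slope y G1 A w)%:M +
    (4 * G2 (dist2 y w.1)) *: ((w.1 - y)^T *m (w.1 - y)).
Proof.
apply/matrixP => i j; rewrite mxE (dxx_radial_test y b A s0 dG dG1).
by rewrite !mxE big_ord1 !mxE -mulr_natr; ring.
Qed.

Lemma enorm_grad_radial_test w :
  enorm (grad_x phi w) ^+ 2 =
  4 * radial_slope y G1 A w ^+ 2 * dist2 y w.1.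
Proof.
rewrite enorm_sqr /dist2 mulr_sumr; apply: eq_bigr => i _.
by rewrite mxE (dx_radial_test y b A s0 dG); ring.
Qed.

(** For a function that is decreasing and concave in the squared distance all
    eigenvalues of the Hessian are nonpositive, so Pucci's infimum weighs each of
    them with [Lam] at most; ellipticity compares the Hessian with the zero
    matrix, where [F] vanishes. *)
Lemma residual_radial_test_le w :
  radial_slope y G1 A w <= 0 -> G2 (dist2 y w.1) <= 0 ->
  residual F f phi w <=
    A * (dist2 y w.1 - s0) - b1 w.2
    - 2 * Lam * (n%:R * radial_slope y G1 A w +
                 2 * G2 (dist2 y w.1) * dist2 y w.1)
    - f (grad_x phi w).
Proof.
move=> s_le0 G2_le0; rewrite /residual (dt_radial_test y G A s0 db).
have hs : symm (hess_x phi w).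
  rewrite /symm /= hess_radial_test linearD/= tr_scalar_mx linearZ/=.
  by rewrite trmx_mul trmxK.
have s0' : symm (0 : 'M[R]_n) by rewrite /symm /= trmx0.
have /andP[+ _] := ellF hs s0'; rewrite subr0 F0 subr0.
have s2 : 2 * radial_slope y G1 A w <= 0 by lra.
have c4 : 4 * G2 (dist2 y w.1) <= 0 by lra.
have := pucci_minus_rank_one lam_lt (w.1 - y) s2 c4.
rewrite hess_radial_test -enorm_sqr -dist2_enorm; lra.
Qed.

End Residual.

End Subsolutions.

(** * Comparison with smooth strict subsolutions *)

Section Comparison.
Variables (R : realType) (n : nat) (Omega : set 'rV[R]_n).
Variables (F : 'M[R]_n -> R) (f : 'rV[R]_n -> R).
Implicit Types (phi u : 'rV[R]_n * R -> R) (z : 'rV[R]_n * R).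

Lemma derive_addc (V : normedModType R) (g : V -> R) (c : R) (a v : V) :
  'D_v (fun w => g w + c) a = 'D_v g a.
Proof.
rewrite /derive (_ : (fun e : R => _) =
  fun e : R => e^-1 *: ((g \o shift a) (e *: v) - g a))//.
by apply/funext => e /=; congr (_ *: _); ring.
Qed.

Lemma derivable_addc (V : normedModType R) (g : V -> R) (c : R) (a v : V) :
  derivable g a v -> derivable (fun w => g w + c) a v.
Proof.
rewrite /derivable (_ : (fun e : R => e^-1 *:
    (((fun w => g w + c) \o shift a) (e *: v) - (g a + c))) =
  fun e : R => e^-1 *: ((g \o shift a) (e *: v) - g a))//.
by apply/funext => e /=; congr (_ *: _); ring.
Qed.

Lemma dx_addc phi c i : dx i (fun w => phi w + c) = dx i phi.
Proof. by apply/funext => z; rewrite /dx derive_addc. Qed.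

Lemma dt_addc phi c : dt (fun w => phi w + c) = dt phi.
Proof. by apply/funext => z; rewrite /dt derive_addc. Qed.

Lemma residual_addc phi c z :
  residual F f (fun w => phi w + c) z = residual F f phi z.
Proof.
have hessE : hess_x (fun w => phi w + c) z = hess_x phi z.
  by apply: eq_mx => i j; exact: (congr1 (fun g => dx i g z) (dx_addc phi c j)).
have gradE : grad_x (fun w => phi w + c) z = grad_x phi z.
  by apply/rowP => i; rewrite mxE (dx_addc phi c i) [RHS]mxE.
by rewrite /residual dt_addc hessE gradE.
Qed.

Lemma C21_near_addc phi c z :
  C21_near phi z -> C21_near (fun w => phi w + c) z.
Proof.
apply: filterS => w [[d1 c1] H1 H2]; split.
- by rewrite (dt_addc phi c); split; [exact: derivable_addc|].
- move=> i; have [d2 c2] := H1 i; rewrite (dx_addc phi c i).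
  by split; [exact: derivable_addc|].
- by move=> i j; rewrite (dx_addc phi c j); exact: H2.
Qed.

Lemma closure_bounded (B : set 'rV[R]_n) :
  bounded_set B -> bounded_set (closure B).
Proof.
move=> [M [Mreal MB]]; exists (M + 1); split; first by rewrite num_real.
move=> r rM x clx.
have M1 : M < M + 1 by rewrite ltrDl.
have e0 : 0 < r - (M + 1) by rewrite subr_gt0.
have [z [Bz]] := clx _ (nbhsx_ballx x _ e0).
rewrite -ball_normE /= => xz.
have zM : `|z| <= M + 1 := MB _ M1 _ Bz.
have := ler_normD (x - z) z; rewrite subrK; lra.
Qed.

(** At a negative minimum of [u - phi] the function [phi], lifted by a constant,
    touches [u] from below, so its residual cannot be negative. On the lateral
    boundary the viscosity condition yields either that same conclusion or
    [0 <= u]; this is why nonpositive values of [phi] are harmless there. The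
    bound at the final time keeps the minimum away from [T], where the touching
    would only be one-sided in time. *)
Lemma comparison (u0 : 'rV[R]_n -> R) u phi (T : R) :
  open Omega -> bounded_set Omega -> is_solution Omega F f u0 u -> 0 < T ->
  continuous phi -> (forall z, C21_near phi z) ->
  (forall x, closure Omega x -> phi (x, 0) <= u (x, 0)) ->
  (forall x, closure Omega x -> phi (x, T) <= u (x, T)) ->
  (forall x t, bdry Omega x -> 0 < t < T ->
    phi (x, t) <= u (x, t) \/
    phi (x, t) <= 0 /\ residual F f phi (x, t) < 0) ->
  (forall x t, Omega x -> 0 < t < T -> u (x, t) < phi (x, t) ->
    residual F f phi (x, t) < 0) ->
  forall x t, closure Omega x -> 0 <= t <= T -> phi (x, t) <= u (x, t).
Proof.
move=> oO bO [uc uint ubd _] T0 phic phiC init final lateral inner x t clx tT.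
rewrite leNgt; apply/negP => uphi.
pose K := closure Omega `*` `[0, T].
have Kxt : K (x, t) by split => //=; rewrite in_itv.
have Kc : compact K.
  apply: compact_setX; last exact: segment_compact.
  by apply: bounded_closed_compact; [exact: closure_bounded|exact: closed_closure].
have Kd : {within K, continuous (fun z => u z - phi z)}.
  apply: within_continuousB; last exact: continuous_subspaceT.
  apply: continuous_subspaceW uc => -[x' t'] [? /=]; rewrite in_itv/= => /andP[? _].
  by split.
have [[x1 t1] + min1] := compact_EVT_min (ex_intro _ _ Kxt) Kc Kd.
rewrite inE => -[/= clx1]; rewrite in_itv/= => /andP[t10 t1T].
have neg1 : u (x1, t1) < phi (x1, t1).
  by have := min1 (x, t); rewrite inE => /(_ Kxt); lra.
have {}t10 : 0 < t1.
  rewrite lt_neqAle t10 andbT; apply/negP => /eqP t1E.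
  by have := init x1 clx1; move: neg1; rewrite -t1E; lra.
have {}t1T : t1 < T.
  rewrite lt_neqAle t1T andbT; apply/negP => /eqP t1E.
  by have := final x1 clx1; move: neg1; rewrite t1E; lra.
pose c := u (x1, t1) - phi (x1, t1).
have touch (D : set 'rV[R]_n) : D `<=` closure Omega ->
    touches_below (D `*` [set s | 0 < s]) u (fun w => phi w + c) (x1, t1).
  move=> DO; split; first by rewrite /c; ring.
  have nT : \forall w \near (x1, t1), w.2 < T.
    have sndc : {for (x1, t1), continuous (fun w : 'rV[R]_n * R => w.2)}.
      exact: cvg_snd.
    by apply: (sndc [set s | s < T]); exact: lt_nbhsl.
  apply: filterS nT => -[x' t'] /= t'T [/= Dx' t'0].
  have := min1 (x', t'); rewrite inE /c => H.
  suff : u (x1, t1) - phi (x1, t1) <= u (x', t') - phi (x', t') by lra.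
  apply: H; split; first exact: DO.
  by rewrite /= in_itv/= !ltW.
have C := C21_near_addc c (phiC (x1, t1)).
have t1' : 0 < t1 < T by rewrite t10.
have [Ox1|nOx1] := pselect (Omega x1).
  have [_ /(_ (touch _ (@subset_closure _ Omega)))] :=
    uint (x1, t1) (conj Ox1 t10) _ C.
  by rewrite residual_addc leNgt inner.
have bx1 : bdry Omega x1.
  by split => //; move=> /interior_subset.
have [|[phi0 res0]] := lateral x1 t1 bx1 t1'; first by rewrite leNgt neg1.
have [_ /(_ (touch _ (@subset_refl _ _)))] := ubd (x1, t1) (conj bx1 t10) _ C.
rewrite residual_addc le_max; apply/negP; rewrite negb_or -!ltNge res0/=; lra.
Qed.

End Comparison.

(** * A boundary point *)

(** The first coordinate attains its maximum over the compact closure; at a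
    point of the open set it could still be increased. *)
Lemma boundary_nonempty (R : realType) (n : nat) (Omega : set 'rV[R]_n) :
  (0 < n)%N -> open Omega -> bounded_set Omega -> Omega !=set0 ->
  bdry Omega !=set0.
Proof.
move=> n_gt0 oO bO [z Oz]; pose i := Ordinal n_gt0.
have cO : compact (closure Omega).
  by apply: bounded_closed_compact; [exact: closure_bounded|exact: closed_closure].
have ic : {within closure Omega, continuous (fun x : 'rV[R]_n => x 0 i)}.
  by apply: continuous_subspaceT => x; exact: coord_continuous.
have [x + xmax] := compact_EVT_max (ex_intro _ z (subset_closure Oz)) cO ic.
rewrite inE => clx; exists x; split => // /interior_subset Ox.
have nO : \forall e \near (0 : R), Omega (e *: delta_mx 0 i + x).
  by apply: (@line_cvg _ _ x (delta_mx 0 i)); exact: open_nbhs_nbhs.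
have [e [Oe e0]] : exists e : R, Omega (e *: delta_mx 0 i + x) /\ 0 < e.
  have [eps /= eps0 ballO] := nO.
  exists (eps / 2); split; last by rewrite divr_gt0.
  by apply: ballO; rewrite /= sub0r normrN gtr0_norm ?divr_gt0//; lra.
have := xmax (e *: delta_mx 0 i + x); rewrite inE => /(_ (subset_closure Oe)).
by rewrite !mxE !eqxx mulr1; lra.
Qed.

(** * Nonnegativity of solutions *)

Section Nonnegativity.
Variables (R : realType) (n : nat) (lam Lam : R) (Omega : set 'rV[R]_n).
Variables (F : 'M[R]_n -> R) (f : 'rV[R]_n -> R).
Hypothesis lam_lt : lam < Lam.
Hypothesis F0 : F 0 = 0.
Hypothesis ellF : uniformly_elliptic lam Lam F.
Hypothesis f_ge0 : forall xi, 0 <= f xi.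
Hypothesis oO : open Omega.
Hypothesis bO : bounded_set Omega.

(** Compare with the space-independent function [- b t]. It has to be strictly
    decreasing, small in absolute value at the time [t] of interest, and below
    the minimum of [u] at the later time [2 * t]; hence the linear term with a
    tiny coefficient and the quadratic term switched on after [t]. *)
Lemma solution_ge0 (u0 : 'rV[R]_n -> R) u :
  is_solution Omega F f u0 u -> (forall x, closure Omega x -> 0 <= u0 x) ->
  forall x t, closure Omega x -> 0 <= t -> 0 <= u (x, t).
Proof.
move=> sol u0_ge0 x t clx t0; have [uc _ _ init] := sol.
have [->|{}t0] : t = 0 \/ 0 < t.
    by move: t0; rewrite le_eqVlt => /orP[/eqP <-|]; [left|right].
  by rewrite init// u0_ge0.
pose K := closure Omega `*` `[0, 2 * t].
have Kc : compact K.
  apply: compact_setX; last exact: segment_compact.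
  by apply: bounded_closed_compact; [exact: closure_bounded|exact: closed_closure].
have Kd : {within K, continuous u}.
  apply: continuous_subspaceW uc => -[x' t'] [? /=]; rewrite in_itv/= => /andP[? _].
  by split.
have Kx : K (x, t) by split => //=; rewrite in_itv/=; apply/andP; split; lra.
have [z _ umin] := compact_EVT_min (ex_intro _ _ Kx) Kc Kd.
pose M := `|u z| / t ^+ 2.
have tt : 0 < t ^+ 2 by rewrite exprn_gt0.
have MtE : M * t ^+ 2 = `|u z| by rewrite /M divfK// gt_eqF.
rewrite leNgt; apply/negP => u_lt0.
pose beta := - u (x, t) / (2 * t).
have beta0 : 0 < beta by rewrite divr_gt0// ?oppr_gt0// mulr_gt0.
pose b (s : R) := beta * s + M * pos (s - t) ^+ 2.
pose b1 (s : R) := beta + 2 * M * pos (s - t).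
have db s : is_derive s (1 : R) b (b1 s).
  have dsq := @is_derive_affine _ (fun z => pos z ^+ 2) 1 (- t) s _
    (is_derive_pos_sqr _).
  have dl := is_derive_affine_add beta 0 (is_derive_cst (0 : R) s 1).
  rewrite (_ : b = fun s => (fun x => cst 0 x + beta * x + 0) s
    - (- M) * pos (1 * s + - t) ^+ 2); last first.
    by apply/funext => s' /=; rewrite /b add0r addr0 mul1r; ring.
  apply: (is_derive_eq (is_derive_subZ (- M) dl dsq)).
  by rewrite /b1 mul1r; ring.
have b1c : continuous b1.
  move=> s; apply: cvgD; first exact: cvg_cst.
  apply: cvgM; first exact: cvg_cst.
  apply: (@continuous_comp _ _ _ (fun s => s - t) (@pos R)).
    by apply: cvgB; [exact: cvg_id|exact: cvg_cst].
  exact: pos_continuous.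
have dz s : is_derive s (1 : R) (cst 0 : R -> R) ((cst 0 : R -> R) s).
  exact: is_derive_cst.
pose phi := radial_test (0 : 'rV[R]_n) (cst 0) b 0 0.
have M0 : 0 <= M by rewrite divr_ge0// ltW.
have res w : 0 < w.2 -> residual F f phi w < 0.
  move=> w0.
  have := @residual_radial_test_le _ _ _ _ _ f lam_lt F0 ellF 0 _ _ _ _ _ 0 0
    dz dz db w.
  rewrite /radial_slope !mul0r addr0 lexx => /(_ isT isT).
  have := f_ge0 (grad_x phi w).
  have : 0 < b1 w.2 by rewrite ltr_wpDr// mulr_ge0 ?pos_ge0// mulr_ge0.
  rewrite -/phi !mulr0 !mul0r !addr0 !sub0r !mulr0 !subr0; lra.
have phiE x' t' : phi (x', t') = - b t'.
  by rewrite /phi /radial_test /= !mul0r add0r sub0r.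
have : phi (x, t) <= u (x, t).
  apply: (@comparison _ _ _ _ _ _ _ phi (2 * t) oO bO sol) => //; try lra.
  - exact: (@radial_test_continuous _ _ 0 _ _ _ _ 0 0 dz db).
  - move=> w; apply: (radial_test_C21 _ _ _ dz dz _ db) => //.
    exact: cst_continuous.
  - move=> x' clx'; rewrite phiE init// /b mulr0 add0r pos_eq0; last by lra.
    by rewrite expr0n/= mulr0 oppr0 u0_ge0.
  - move=> x' clx'; rewrite phiE.
    have Kx' : K (x', 2 * t).
      by split => //=; rewrite in_itv/=; apply/andP; split; lra.
    have := umin (x', 2 * t); rewrite inE => /(_ Kx').
    have -> : b (2 * t) = beta * (2 * t) + `|u z|.
      rewrite /b pos_id; last by lra.
      have -> : 2 * t - t = t by ring.
      by rewrite MtE.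
    have : 0 < beta * (2 * t) by rewrite mulr_gt0// mulr_gt0.
    have := ler_norm (- u z); rewrite normrN; lra.
  - move=> x' t' bx' /andP[t'0 _]; right; split; last exact: res.
    rewrite phiE oppr_le0 addr_ge0//; last by rewrite mulr_ge0// sqr_ge0.
    by rewrite mulr_ge0 ?ltW.
  - by move=> x' t' _ /andP[t'0 _] _; exact: res.
rewrite phiE /b subrr pos_eq0// expr0n/= mulr0 addr0 /beta.
have -> : - (- u (x, t) / (2 * t) * t) = u (x, t) / 2.
  by field; rewrite gt_eqF.
lra.
Qed.

End Nonnegativity.

(** * The barrier *)

(** The ball of centre [y] and radius [rho] touches the boundary from inside.
    The barrier is the radial function built on [profile], shifted by [delta] so
    that its steep part lies inside the ball, with the drift and a final
    quadratic decay in time. *)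

Section Barrier.
Variables (R : realType) (n : nat) (lam Lam : R) (Omega : set 'rV[R]_n).
Variables (F : 'M[R]_n -> R) (f : 'rV[R]_n -> R) (h : R -> R).
Hypothesis n_gt0 : (0 < n)%N.
Hypothesis lam_gt0 : 0 < lam.
Hypothesis lam_lt : lam < Lam.
Hypothesis F0 : F 0 = 0.
Hypothesis ellF : uniformly_elliptic lam Lam F.
Hypothesis h_gt0 : forall s : R, 0 < s -> 0 < h s.
Hypothesis h_nondec : forall s t : R, 0 < s -> s <= t -> h s <= h t.
Hypothesis f_ge : forall xi, enorm xi ^+ 2 * h (enorm xi) <= f xi.
Hypothesis oO : open Omega.
Hypothesis bO : bounded_set Omega.

Variables (y : 'rV[R]_n) (rho m : R) (j : nat).
Let Q := rho ^+ 2.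
Hypothesis rho_gt0 : 0 < rho.
Hypothesis m_gt0 : 0 < m.
Hypothesis level_m : rho / 2 * m = 2 ^+ j.
Hypothesis m_big : 256 * n%:R * Lam < m * Q * h 1.
Hypothesis mQ_big : 1024 <= m * Q.
Hypothesis tail_small :
  forall N, 128 * Lam * \sum_(k < N) (h (2 ^+ (j + k)))^-1 <= 1 / 2.
Hypothesis bdry_far : forall x, bdry Omega x -> Q <= dist2 y x.

(** With these lengths, [curvature_le] applies to
    [s ^+ 2 * h (rho / 2 * s) / (32 * Lam)]. This is a fixed fraction of the
    superquadratic term, because the gradient of the barrier has norm at least
    [rho / 2 * s] where the squared distance is at least [Q / 4] and the slope
    of the profile is [s]. *)
Let r k : R := 128 * Lam / (2 ^+ k * m * h (2 ^+ (j + k))).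

Let Lam_gt0 : 0 < Lam.
Proof. exact: lt_trans lam_lt. Qed.

Let Q_gt0 : 0 < Q.
Proof. by rewrite exprn_gt0. Qed.

Let n_ge1 : 1 <= n%:R :> R.
Proof. by rewrite ler1n. Qed.

Let level_pow k : rho / 2 * (2 ^+ k * m) = 2 ^+ (j + k).
Proof. by rewrite mulrCA level_m -exprD addnC. Qed.

Let hpow_gt0 k : 0 < h (2 ^+ k).
Proof. by rewrite h_gt0// exprn_gt0. Qed.

Let r_gt0 k : 0 < r k.
Proof. by rewrite divr_gt0 ?mulr_gt0 ?exprn_gt0. Qed.

Let r_half k : r k.+1 <= r k / 2.
Proof.
have -> : r k / 2 = 128 * Lam / (2 ^+ k.+1 * m * h (2 ^+ (j + k))).
  rewrite /r exprS; field.
  by rewrite !gt_eqF// exprn_gt0.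
rewrite ler_wpM2l ?mulr_ge0 ?(ltW Lam_gt0)//.
have pm : 0 < 2 ^+ k.+1 * m by rewrite mulr_gt0// exprn_gt0.
rewrite lef_pV2 ?posrE ?mulr_gt0// ler_pM2l//.
by rewrite h_nondec ?exprn_gt0// addnS ler_eXn2l ?ltr1n// leqnSn.
Qed.

Let level_sum N : \sum_(k < N) 2 ^+ k * m * r k <= 1 / 2.
Proof.
apply: le_trans (tail_small N); rewrite mulr_sumr ler_sum// => k _.
rewrite /r; have p0 : 0 < (2 : R) ^+ k by rewrite exprn_gt0.
by rewrite le_eqVlt; apply/orP; left; apply/eqP; field; rewrite !gt_eqF.
Qed.

Let h1_le k : h 1 <= h (2 ^+ k).
Proof. by rewrite h_nondec// exprn_ege1// ler1n. Qed.

Let h_one_gt0 : 0 < h 1.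
Proof. exact: h_gt0. Qed.

Let r0_le : r 0 <= Q / 2.
Proof.
rewrite /r expr0 mul1r ler_pdivrMr ?mulr_gt0//.
have := ler_wpM2l (ltW (mulr_gt0 m_gt0 Q_gt0)) (h1_le (j + 0)).
have := ler_wpM2r (ltW Lam_gt0) n_ge1.
move: m_big; lra.
Qed.

Let f_ge0 xi : 0 <= f xi.
Proof.
apply: le_trans (f_ge xi).
have [->|xi0] := eqVneq (enorm xi) 0; first by rewrite expr0n/= mul0r.
by rewrite mulr_ge0 ?sqr_ge0// ltW// h_gt0// lt0r xi0 enorm_ge0.
Qed.

(** [A] is twice what is needed to beat the diffusion near the centre, where the
    slope equals [m]. Up to time [T1] the drift [A * t] takes away at most half
    of the slope, and [B] makes the barrier nonpositive everywhere at [T1]. *)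
Let A : R := 16 * n%:R * Lam * m / Q.
Let T1 : R := Q / (32 * n%:R * Lam).
Let B : R := 2 * m * Q / T1 ^+ 2.

Let nL_gt0 : 0 < n%:R * Lam.
Proof. by rewrite mulr_gt0// ltr0n. Qed.

Let A_gt0 : 0 < A.
Proof. by rewrite divr_gt0// mulr_gt0// -mulrA mulr_gt0. Qed.

Let T1_gt0 : 0 < T1.
Proof. by rewrite divr_gt0// -mulrA mulr_gt0. Qed.

Let AT1 : A * T1 = m / 2.
Proof.
have : n%:R != 0 :> R by rewrite gt_eqF// ltr0n.
by move=> n0; rewrite /A /T1; field; rewrite n0 !gt_eqF.
Qed.

Let B_gt0 : 0 < B.
Proof. by rewrite divr_gt0 ?exprn_gt0// !mulr_gt0. Qed.

Section Shifted.
Variables (delta : R) (N : nat).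
Hypothesis delta_gt0 : 0 < delta.
Hypothesis delta_le : delta <= Q / 4.
Hypothesis N_big : Q <= 2 ^+ N * delta.

Let G s := profile m Q r N (1 * s + delta).
Let G1 s := - slope m Q r N (1 * s + delta).
Let G2 s := - curvature m Q r N (1 * s + delta).
Let b t := B * t ^+ 2.
Let b1 t := B * (2 * t).

Definition barrier := radial_test y G b A (Q / 2).

Let dG s : is_derive s (1 : R) G (G1 s).
Proof.
have := is_derive_affine (is_derive_profile m Q r_gt0 N (1 * s + delta)).
by rewrite mulr1.
Qed.

Let dG1 s : is_derive s (1 : R) G1 (G2 s).
Proof.
have := is_derive_affine (is_derive_slope m Q r N (1 * s + delta)).
rewrite mulr1 => /is_deriveN; exact.
Qed.

Let db t : is_derive t (1 : R) b (b1 t).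
Proof.
have -> : b = B \*: ((id : R -> R) ^+ 2) by [].
by apply: is_derive_eq; rewrite /GRing.scale/= expr1 mulr1.
Qed.

Let G2_continuous : continuous G2.
Proof.
have affine_cont : continuous (fun s : R => 1 * s + delta).
  move=> s; apply: cvgD; last exact: cvg_cst.
  by apply: cvgM; [exact: cvg_cst|exact: cvg_id].
move=> s; apply: cvgN.
apply: (@continuous_comp _ _ _ (fun s : R => 1 * s + delta) (curvature m Q r N)).
  exact: affine_cont.
exact: curvature_continuous.
Qed.

Let b1_continuous : continuous b1.
Proof.
move=> t; apply: cvgM; first exact: cvg_cst.
by apply: cvgM; [exact: cvg_cst|exact: cvg_id].
Qed.

Let barrierE x t : barrier (x, t) =
  profile m Q r N (dist2 y x + delta) + A * t * (dist2 y x - Q / 2) - B * t ^+ 2.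
Proof. by rewrite /barrier /radial_test /= /G /b mul1r. Qed.

Let dist2_ge0 x : 0 <= dist2 y x.
Proof. by rewrite dist2_enorm sqr_ge0. Qed.

(** The bound does not involve [delta] nor [N]: one initial datum lies above all
    the barriers. It rests on [z - 1 / 2 <= 2 * z ^+ 2] for
    [z = m * (Q - dist2 y x)]. *)
Lemma barrier_start x : barrier (x, 0) <= 2 * m ^+ 2 * pos (Q - dist2 y x) ^+ 2.
Proof.
have d0 := delta_gt0; have m0 := m_gt0.
rewrite barrierE mulr0 mul0r addr0 expr0n/= mulr0 subr0.
have := profile_le Q m_gt0 r_gt0 N (dist2 y x + delta).
have md := mulr_gt0 m_gt0 delta_gt0.
have sq := sqr_ge0 (m * (Q - dist2 y x) - 1 / 2).
have [qQ|qQ] := lerP (dist2 y x) Q.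
  by rewrite pos_id; nra.
rewrite pos_eq0; last by lra.
have := mulr_gt0 m_gt0 (_ : 0 < dist2 y x - Q); rewrite subr_gt0 => /(_ qQ).
by rewrite expr0n/= mulr0; nra.
Qed.

Let At_le t : 0 <= t <= T1 -> 0 <= A * t <= m / 2.
Proof.
move=> /andP[t0 tT]; rewrite mulr_ge0 ?(ltW A_gt0)//= -AT1.
by rewrite ler_wpM2l// ltW.
Qed.

Lemma barrier_stop x : barrier (x, T1) <= 0.
Proof.
have m0 := m_gt0.
rewrite barrierE AT1 /B divfK ?gt_eqF ?exprn_gt0//.
have := profile_le Q m_gt0 r_gt0 N (dist2 y x + delta).
have md := mulr_gt0 m_gt0 delta_gt0.
have mq := mulr_ge0 (ltW m_gt0) (dist2_ge0 x).
have mQ := mulr_gt0 m_gt0 Q_gt0.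
nra.
Qed.

(** With final slope [2 ^+ N * m] the profile loses at least [m * Q] over the
    length [delta], more than the drift adds at [Q]; farther out the profile
    still falls faster than the drift grows. *)
Lemma barrier_outside x t : 0 <= t <= T1 -> Q <= dist2 y x ->
  barrier (x, t) <= 0.
Proof.
have m0 := m_gt0; have d0 := delta_gt0; have Q0 := Q_gt0.
move=> tT qQ; have /andP[At0 At1] := At_le tT.
rewrite barrierE.
have e0 : 0 <= dist2 y x - Q + delta.
  by rewrite addr_ge0 ?subr_ge0// ltW.
have := profile_beyond Q m_gt0 r_gt0 N e0.
have -> : Q + (dist2 y x - Q + delta) = dist2 y x + delta by ring.
have two_ge1 : 1 <= (2 : R) ^+ N by rewrite exprn_ege1// ler1n.
have Bt : 0 <= B * t ^+ 2 by rewrite mulr_ge0 ?sqr_ge0// ltW.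
have out : Q + (dist2 y x - Q) <= 2 ^+ N * (dist2 y x - Q + delta).
  by rewrite [X in 2 ^+ N * X]addrC mulrDr lerD// ler_peMl// subr_ge0.
have mout := ler_wpM2l (ltW m_gt0) out.
have drift : A * t * (dist2 y x - Q / 2) <= m / 2 * (dist2 y x - Q / 2).
  by rewrite ler_wpM2r//; lra.
have mq := mulr_ge0 (ltW m_gt0) (dist2_ge0 x).
nra.
Qed.

Let T : R := (2 * n%:R * Lam * m)^-1.

Lemma loss_time_bounds : 0 < T < T1.
Proof.
have mQ := mQ_big.
have nLm : 0 < n%:R * Lam * m by rewrite mulr_gt0.
apply/andP; split; first by rewrite invr_gt0 -!mulrA mulr_gt0// mulrA.
have n0 : n%:R != 0 :> R by rewrite gt_eqF// ltr0n.
have -> : T1 = m * Q / 16 * T by rewrite /T1 /T; field; rewrite n0 !gt_eqF.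
rewrite ltr_pMl; first by lra.
by rewrite invr_gt0 -!mulrA mulr_gt0// mulrA.
Qed.

(** At the rim the profile is evaluated at [Q], where it is at least [- 1]; by
    the time [T], of order [1 / m], the drift has added at least 2 and the decay
    has taken away at most [1 / 2]. *)
Lemma barrier_rim x : dist2 y x = Q - delta -> 1 / 2 <= barrier (x, T).
Proof.
have mQ := mQ_big; have dQ := delta_le; have Q0 := Q_gt0.
move=> xd; rewrite barrierE xd subrK.
have n0 : n%:R != 0 :> R by rewrite gt_eqF// ltr0n.
have -> : A * T = 8 / Q by rewrite /A /T; field; rewrite n0 !gt_eqF.
have -> : B * T ^+ 2 = 512 / (m * Q).
  by rewrite /B /T1 /T; field; rewrite n0 !gt_eqF.
have drift : 8 / Q * (Q / 4) <= 8 / Q * (Q - delta - Q / 2).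
  by rewrite ler_wpM2l ?divr_ge0 ?(ltW Q_gt0)//; lra.
have E : 8 / Q * (Q / 4) = 2 by field; rewrite gt_eqF.
have kill : 512 / (m * Q) <= 1 / 2.
  rewrite ler_pdivrMr ?mulr_gt0//; lra.
have := profile_end Q m_gt0 r_gt0 (level_sum N); lra.
Qed.

(** Near the centre the drift alone decreases the barrier fast enough to absorb
    the diffusion. Elsewhere the gradient is large and the superquadratic term
    dominates the time derivative and the second order terms, including the
    large curvature of the profile. *)
Lemma barrier_residual x t : 0 <= t <= T1 -> dist2 y x < Q ->
  residual F f barrier (x, t) < 0.
Proof.
have Q0 := Q_gt0; have dQ := delta_le; have m0 := m_gt0; have d0 := delta_gt0.
move=> tT qQ; have /andP[At0 At1] := At_le tT; have /andP[t0 _] := tT.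
set q := dist2 y x in qQ *; have q0 : 0 <= q := dist2_ge0 x.
pose P := slope m Q r N (1 * q + delta).
pose k := curvature m Q r N (1 * q + delta).
have mP : m <= P by exact: slope_ge.
have P0 : 0 < P by lra.
have k0 : 0 <= k by exact: curvature_ge0.
pose S := radial_slope y G1 A (x, t).
have SE : S = - P + A * t by [].
have S_le : S <= - (P / 2) by lra.
have S_ge : - P <= S by lra.
have S0 : S <= 0 by lra.
have := @residual_radial_test_le _ _ _ _ _ f lam_lt F0 ellF y _ _ _ _ _ A (Q / 2)
  dG dG1 db (x, t) S0.
rewrite -/barrier -/S /= -/q /G2 -/k oppr_le0 => /(_ k0).
move=> /le_lt_trans; apply.
have drag : 0 <= b1 t by rewrite mulr_ge0 ?(ltW B_gt0)// mulr_ge0.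
have diffusion : n%:R * Lam * (- S) <= n%:R * Lam * P.
  by rewrite ler_wpM2l ?(ltW nL_gt0)//; lra.
set g := grad_x barrier (x, t); have fg := f_ge0 g.
have [q_small|q_large] := lerP q (Q / 4).
  have [Pm k_eq0] : P = m /\ k = 0.
    by apply: slope_before => //; move: r0_le; lra.
  have AQ : A * (q - Q / 2) <= A * (- (Q / 4)).
    by rewrite ler_wpM2l ?(ltW A_gt0)//; lra.
  have E : A * (- (Q / 4)) = - (4 * (n%:R * Lam * m)).
    by rewrite /A; field; rewrite gt_eqF.
  have : 0 < n%:R * Lam * m by rewrite mulr_gt0.
  rewrite k_eq0 oppr0 mulr0 mul0r addr0 Pm in diffusion *.
  lra.
pose H := h (rho / 2 * P).
have H_ge : h 1 <= H.
  have : 1 <= rho / 2 * P.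
    apply: le_trans (_ : rho / 2 * m <= _).
      by rewrite level_m exprn_ege1// ler1n.
    by rewrite ler_wpM2l// divr_ge0// ltW.
  exact: h_nondec.
have H0 : 0 < H by apply: lt_le_trans H_ge.
have growth : k <= P ^+ 2 * H / (32 * Lam).
  (* the growth rate matched by the choice of [r] *)
  pose gr (s : R) := s ^+ 2 * h (rho / 2 * s) / (32 * Lam).
  apply: (@curvature_le _ _ Q r m_gt0 r_gt0 r_half gr N) => //.
  - move=> s s' ms ss'; rewrite /gr ler_wpM2r ?invr_ge0 ?mulr_ge0 ?(ltW Lam_gt0)//.
    have s_gt0 : 0 < s by lra.
    have rs : 0 < rho / 2 * s by rewrite mulr_gt0// divr_gt0.
    rewrite ler_pM ?sqr_ge0 ?(ltW (h_gt0 rs))//.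
      by rewrite ler_sqr ?nnegrE; lra.
    by rewrite h_nondec// ler_wpM2l// divr_ge0// ltW.
  - apply: divr_ge0; last by rewrite mulr_ge0// ltW.
    by rewrite mulr_ge0 ?sqr_ge0// level_m ltW.
  - move=> i; rewrite /gr level_pow /r le_eqVlt; apply/orP; left; apply/eqP.
    by field; rewrite !gt_eqF ?exprn_gt0.
have gradE : enorm g ^+ 2 = 4 * S ^+ 2 * q.
  exact: (@enorm_grad_radial_test _ _ y G G1 b A (Q / 2) dG (x, t)).
have S2 : P ^+ 2 / 4 <= S ^+ 2.
  have := sqr_ge0 (S + P / 2); nra.
have grad_sq : P ^+ 2 * (Q / 4) <= enorm g ^+ 2.
  rewrite gradE.
  apply: le_trans (_ : P ^+ 2 * q <= _).
    by rewrite ler_wpM2l ?sqr_ge0// ltW.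
  by rewrite ler_wpM2r//; lra.
have grad_ge : rho / 2 * P <= enorm g.
  rewrite -ler_sqr ?nnegrE ?enorm_ge0//.
    apply: le_trans grad_sq; rewrite /Q le_eqVlt; apply/orP; left; apply/eqP.
    by field.
  by rewrite mulr_ge0 ?divr_ge0 ?ltW.
have reaction : P ^+ 2 * (Q / 4) * H <= f g.
  apply: le_trans (f_ge g).
  apply: ler_pM => //; last by apply: h_nondec => //; rewrite mulr_gt0// divr_gt0.
  - by apply: mulr_ge0; [exact: sqr_ge0|rewrite divr_ge0 ?ltW].
  - exact: ltW.
have source : A * (q - Q / 2) <= 8 * (n%:R * Lam * P).
  apply: le_trans (_ : A * (Q / 2) <= _).
    by rewrite ler_wpM2l ?(ltW A_gt0)//; lra.
  have -> : A * (Q / 2) = 8 * (n%:R * Lam * m) by rewrite /A; field; rewrite gt_eqF.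
  by rewrite ler_wpM2l// ler_wpM2l ?(ltW nL_gt0).
have bending : Lam * k * q <= P ^+ 2 * H * Q / 32.
  apply: le_trans (_ : Lam * (P ^+ 2 * H / (32 * Lam)) * Q <= _); last first.
    by rewrite le_eqVlt; apply/orP; left; apply/eqP; field; rewrite gt_eqF.
  apply: ler_pM => //; last exact: ltW.
  - by rewrite mulr_ge0 ?(ltW Lam_gt0).
  - by rewrite ler_wpM2l ?(ltW Lam_gt0).
have win : 80 * (n%:R * Lam * P) < P ^+ 2 * H * Q.
  have mH : m * Q * h 1 <= P * Q * H.
    apply: ler_pM => //; last by rewrite ler_wpM2r ?(ltW Q_gt0).
    - by rewrite mulr_ge0 ?(ltW m_gt0) ?(ltW Q_gt0).
    - exact: ltW.
  have -> : 80 * (n%:R * Lam * P) = 80 * (n%:R * Lam) * P by ring.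
  have -> : P ^+ 2 * H * Q = P * Q * H * P by ring.
  rewrite ltr_pM2r//; move: m_big nL_gt0; lra.
lra.
Qed.

(** Where [u] lies below the barrier, the barrier is positive because [u] is
    nonnegative, hence the point is inside the ball and the residual is
    negative. *)
Lemma solution_ge_barrier u :
  is_solution Omega F f (fun x => 2 * m ^+ 2 * pos (Q - dist2 y x) ^+ 2) u ->
  forall x t, closure Omega x -> 0 <= t <= T1 -> barrier (x, t) <= u (x, t).
Proof.
move=> sol; have [_ _ _ init] := sol.
have u0_ge0 x : 0 <= 2 * m ^+ 2 * pos (Q - dist2 y x) ^+ 2.
  by rewrite mulr_ge0 ?sqr_ge0// mulr_ge0 ?sqr_ge0.
have u_ge0 := solution_ge0 lam_lt F0 ellF f_ge0 oO bO sol (fun x _ => u0_ge0 x).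
apply: (comparison oO bO sol) => //.
- exact: (@radial_test_continuous _ _ y _ _ _ _ A (Q / 2) dG db).
- by move=> z; apply: (radial_test_C21 _ _ _ dG dG1 _ db).
- by move=> x clx; rewrite init//; exact: barrier_start.
- move=> x clx; apply: le_trans (barrier_stop x) _.
  by apply: u_ge0 => //; exact: ltW.
- move=> x t bx /andP[t0 tT]; left.
  apply: le_trans (u_ge0 x t _ (ltW t0)); last by case: bx.
  by apply: barrier_outside (bdry_far bx); rewrite !ltW.
- move=> x t Ox /andP[t0 tT] ux; apply: barrier_residual; first by rewrite !ltW.
  rewrite ltNge; apply/negP => qQ.
  have := u_ge0 x t (subset_closure Ox) (ltW t0).
  have : barrier (x, t) <= 0 by apply: barrier_outside qQ; rewrite !ltW.
  lra.
Qed.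

End Shifted.

(** For a point at squared distance [q] the barrier with [delta = Q - q] has its
    rim exactly there. The bound [1 / 2] and the time do not depend on [q], so
    it survives as the point approaches the boundary. *)
Lemma solution_large_at_rim u x : let T := (2 * n%:R * Lam * m)^-1 in
  is_solution Omega F f (fun x => 2 * m ^+ 2 * pos (Q - dist2 y x) ^+ 2) u ->
  closure Omega x -> 3 / 4 * Q <= dist2 y x < Q -> 1 / 2 <= u (x, T).
Proof.
have Q0 := Q_gt0.
move=> T sol clx /andP[xl xr].
have d0 : 0 < Q - dist2 y x by lra.
have dQ : Q - dist2 y x <= Q / 4 by lra.
(* doublings make the final slope beat the shift, however small it is *)
have [N NQ] : exists N, Q <= 2 ^+ N * (Q - dist2 y x).
  pose N := Num.truncn (Q / (Q - dist2 y x)).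
  exists N.+1; rewrite -ler_pdivrMr//; apply: ltW.
  apply: lt_le_trans (truncnS_gt _) _.
  by rewrite -natrX ler_nat ltnW// ltn_expl.
have /andP[T0 TT] := loss_time_bounds.
apply: le_trans (solution_ge_barrier d0 dQ NQ sol clx _); last by rewrite !ltW.
by apply: barrier_rim => //; rewrite opprB addrC subrK.
Qed.

End Barrier.

(** * Loss of boundary conditions *)

Lemma sqr_subl_bounds (R : realFieldType) (e : R) :
  0 < e <= 1 / 8 -> 3 / 4 <= (1 - e) ^+ 2 < 1.
Proof. by move=> /andP[e0 e8]; apply/andP; split; nra. Qed.

Lemma quadratic_bump_C1 (R : realType) (n : nat) (Omega : set 'rV[R]_n)
    (y : 'rV[R]_n) (a Q : R) :
  C1_closure Omega (fun x => a * pos (Q - dist2 y x) ^+ 2).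
Proof.
pose K (s : R) := a * pos (-1 * s + Q) ^+ 2.
pose K1 (s : R) := - (2 * a) * pos (-1 * s + Q).
have dK s : is_derive s (1 : R) K (K1 s).
  have d := @is_derive_affine _ (fun z => pos z ^+ 2) (- 1) Q s _
    (is_derive_pos_sqr _).
  rewrite (_ : K = fun s => cst 0 s - (- a) * pos (- 1 * s + Q) ^+ 2).
    apply: (is_derive_eq (is_derive_subZ (- a) (is_derive_cst (0 : R) s 1) d)).
    by rewrite /K1; ring.
  by apply/funext => s'; rewrite /K /cst; ring.
have K1c : continuous K1.
  have lin : continuous (fun s : R => -1 * s + Q).
    move=> s; apply: cvgD; last exact: cvg_cst.
    by apply: cvgM; [exact: cvg_cst|exact: cvg_id].
  move=> s; apply: cvgM; first exact: cvg_cst.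
  apply: (@continuous_comp _ _ _ (fun s : R => -1 * s + Q) (@pos R)).
    exact: lin.
  exact: pos_continuous.
have -> : (fun x => a * pos (Q - dist2 y x) ^+ 2) = K \o dist2 y.
  by apply/funext => x; rewrite /K /= mulN1r addrC.
split.
  apply: continuous_subspaceT => x.
  apply: continuous_comp; first exact: dist2_continuous.
  exact: (derivable1_continuous dK).
have K1d : continuous (fun x => K1 (dist2 y x)).
  move=> x; apply: (@continuous_comp _ _ _ (dist2 y) K1); last exact: K1c.
  exact: dist2_continuous.
have grad_cont : continuous (fun x : 'rV[R]_n => K1 (dist2 y x) *: (2 *: (x - y))).
  move=> x; apply: (@continuousZ R _ _ (fun x => K1 (dist2 y x))
    (fun x => 2 *: (x - y))); first exact: K1d.
  have c1 : {for x, continuous (fun x : 'rV[R]_n => x - y)}.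
    by apply: continuousB; [exact: cvg_id|exact: cst_continuous].
  exact: continuousZl_tmp c1.
exists (fun x => K1 (dist2 y x) *: (2 *: (x - y))).
  exact: continuous_subspaceT.
move=> x _ i.
have : is_derive x (delta_mx 0 i) (K \o dist2 y)
    (K1 (dist2 y x) * (2 * (x 0 i - y 0 i))).
  by apply: is_derive_line; exact: is_derive_radial_comp.
by move=> [d dE]; split => //; rewrite dE !mxE.
Qed.

Unset Implicit Arguments.
Set Strict Implicit.

Theorem theorem1p3 (R : realType) (n : nat) (n_gt0 : (0 < n)%N)
  (Omega : set 'rV[R]_n)
  (domOmega : bounded_domain Omega)
  (intOmega : interior_sphere Omega)
  (extOmega : exterior_sphere Omega)
  (lam Lam : R) (lam_gt0 : 0 < lam) (lam_lt : lam < Lam)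
  (F : 'M[R]_n -> R) (F0 : F 0 = 0) (ellF : uniformly_elliptic lam Lam F)
  (h : R -> R)
  (h_gt0 : forall s, 0 < s -> 0 < h s)
  (h_nondec : forall s t, 0 < s -> s <= t -> h s <= h t)
  (h_convex : convex_function (E := R^o) [set s : R | 0 <= s]
                (fun s : R => s ^+ 2 * h s))
  (h_mul : exists2 C : R, 0 < C & exists2 M : R, 0 < M &
     forall y z, M <= y -> M <= z -> h (y * z) <= C * (h y + h z))
  (h_int : (\int[lebesgue_measure]_(s in `[1%R, +oo[) ((s * h s)^-1)%:E < +oo)%E)
  (f : 'rV[R]_n -> R) (f_cont : continuous f)
  (f_ge : forall xi, enorm xi ^+ 2 * h (enorm xi) <= f xi) :
  exists u0 : 'rV[R]_n -> R,
    [/\ C1_closure Omega u0,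
        forall x, closure Omega x -> 0 <= u0 x,
        forall x, bdry Omega x -> u0 x = 0 &
        exists2 T : R, 0 < T &
          forall u : 'rV[R]_n * R -> R,
            is_solution Omega F f u0 u -> LOBC_at Omega u T].
Proof.
have [oO _ O0 bO] := domOmega.
have [x0 bx0] := boundary_nonempty n_gt0 oO bO O0.
have [rho rho0 spheres] := intOmega.
have [y ballO x0y] := spheres x0 bx0.
have Lam0 : 0 < Lam := lt_trans lam_gt0 lam_lt.
pose Q := rho ^+ 2; have Q0 : 0 < Q by rewrite exprn_gt0.
have h1 : 0 < h 1 by rewrite h_gt0.
have L0 : 0 < 128 * Lam by rewrite mulr_gt0.
have tail0 : 0 < 1 / 2 / (128 * Lam) by rewrite divr_gt0.
(* the steep part of the profile may gain at most 1 / 2 in height *)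
have [j0 tail] := dyadic_tail_small h_gt0 h_nondec h_int tail0.
(* [X] collects the lower bounds wanted on [m]; the choice of [m] makes
   [rho / 2] times the slope [2 ^+ k * m] the dyadic number [2 ^+ (j + k)] *)
pose X := 256 * n%:R * Lam / (Q * h 1) + 1024 / Q + 1.
have [j [jj0 jX]] : exists j, (j0 <= j)%N /\ rho / 2 * X <= 2 ^+ j.
  pose j1 := Num.truncn (rho / 2 * X).
  exists (maxn j0 j1.+1); split; first exact: leq_maxl.
  apply: ltW; apply: lt_le_trans (truncnS_gt _) _.
  rewrite -natrX ler_nat ltnW//.
  by apply: leq_trans (@ltn_expl 2 j1.+1 isT) _; rewrite leq_exp2l// leq_maxr.
pose m := 2 ^+ j / (rho / 2).
have rho2 : 0 < rho / 2 by rewrite divr_gt0.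
have m0 : 0 < m by rewrite divr_gt0// exprn_gt0.
have level_m : rho / 2 * m = 2 ^+ j by rewrite mulrC divfK// gt_eqF.
have mX : X <= m by rewrite ler_pdivlMr// mulrC.
have nL0 : 0 <= 256 * n%:R * Lam / (Q * h 1).
  apply: divr_ge0; last exact/ltW/mulr_gt0.
  have nL : 0 <= n%:R * Lam by apply: mulr_ge0; [exact: ler0n|exact: ltW].
  lra.
have QX : 0 <= 1024 / Q by apply: divr_ge0; [exact: ler0n|exact: ltW].
have m_big : 256 * n%:R * Lam < m * Q * h 1.
  rewrite -[m * Q * h 1]mulrA -ltr_pdivrMr; last exact: mulr_gt0.
  by apply: lt_le_trans mX; rewrite /X -addrA ltrDl ltr_wpDl.
have mQ : 1024 <= m * Q.
  rewrite -ler_pdivrMr; last exact: Q0.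
  by apply: le_trans mX; rewrite /X addrAC lerDr addr_ge0.
have tail_small N : 128 * Lam * \sum_(k < N) (h (2 ^+ (j + k)))^-1 <= 1 / 2.
  by rewrite mulrC -ler_pdivlMr//; exact: tail.
have bdry_far x : bdry Omega x -> Q <= dist2 y x.
  move=> [_]; rewrite (interior_id _).1// => nOx.
  rewrite leNgt dist2_enorm; apply/negP => xQ; apply: nOx; apply: ballO.
  by rewrite /eball /= -ltr_sqr ?nnegrE ?enorm_ge0// ltW.
exists (fun x => 2 * m ^+ 2 * pos (Q - dist2 y x) ^+ 2); split.
- exact: quadratic_bump_C1.
- by move=> x _; rewrite mulr_ge0 ?sqr_ge0// mulr_ge0 ?sqr_ge0.
- by move=> x /bdry_far Qx; rewrite pos_eq0 ?subr_le0// expr0n/= mulr0.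
have T0 : 0 < (2 * n%:R * Lam * m)^-1.
  have n0 : 0 < n%:R :> R by rewrite ltr0n.
  by rewrite invr_gt0 mulr_gt0// mulr_gt0// mulr_gt0.
exists (2 * n%:R * Lam * m)^-1 => //.
set T := _^-1 in T0 * => u sol; exists x0 => // uT.
have [uc _ _ _] := sol; have [clx0 _] := bx0.
have /subspace_continuousP/(_ (x0, T)) := uc.
have D0 : (closure Omega `*` [set t | 0 <= t]) (x0, T) by split => //=; exact: ltW.
move=> /(_ D0) u_near.
have small : \forall z \near within (closure Omega `*` [set t | 0 <= t])
    (nbhs (x0, T)), u z < 1 / 2.
  have uT_lt : u (x0, T) < 1 / 2 by rewrite uT divr_gt0.
  exact: (u_near [set s | s < 1 / 2] (lt_nbhsl uT_lt)).
(* approach [x0] along the radius of the interior ball *)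
pose path (e : R) : 'rV[R]_n * R := (e *: (y - x0) + x0, T).
have path_cvg : path @ (0 : R) --> (x0, T).
  exact: (cvg_pair (@line_cvg R _ x0 (y - x0)) (cvg_cst T)).
have [eps /= eps0 path_small] := path_cvg _ small.
have [e [e0 e8 ee]] : exists e : R, [/\ 0 < e, e <= 1 / 8 & e < eps].
  exists (Num.min (eps / 2) (1 / 8)); split.
  - by rewrite lt_min !divr_gt0.
  - by rewrite ge_min lexx orbT.
  - by rewrite gt_min ltr_pdivrMr// ltr_pMr// ltr1n.
pose x := e *: (y - x0) + x0.
have distx : dist2 y x = (1 - e) ^+ 2 * Q.
  rewrite /Q -x0y -dist2_enorm /dist2 mulr_sumr; apply: eq_bigr => i _.
  by rewrite !mxE; ring.
have xQ : 3 / 4 * Q <= dist2 y x < Q.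
  by rewrite distx ler_pM2r// gtr_pMl//; apply: sqr_subl_bounds; rewrite e0.
have clx : closure Omega x.
  apply: subset_closure; apply: ballO; rewrite /eball /=.
  rewrite -ltr_sqr ?nnegrE ?enorm_ge0//; last exact: ltW.
  by rewrite -dist2_enorm; case/andP: xQ.
have : u (x, T) < 1 / 2.
  apply: (path_small e); last by split => //=; exact: ltW.
  by rewrite /= sub0r normrN gtr0_norm.
apply/negP; rewrite -leNgt.
exact: (solution_large_at_rim n_gt0 lam_gt0 lam_lt F0 ellF h_gt0 h_nondec f_ge oO bO
  rho0 m0 level_m m_big mQ tail_small bdry_far sol clx xQ).
Qed.
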